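(* Let $k$ be an algebraically closed field of characteristic $2$, let $f\in k[x,y,z,w]$ be one of the labelled polynomials in the list (L) given in the context, and let $X:=\operatorname{Spec}k[x,y,z,w]/(f)$. Then the following assertions hold. (i) $X$ is $F$-pure if and only if its type (label) is one of $\mathbf{E_7^3F_4}$, $\mathbf{D_4^1B_1}$, $\mathbf{D_4^1B_2}$, $\mathbf{D_5^1C_3}$, $\mathbf{D_{2n}^{n-1}B_{n-1}}$, $\mathbf{D_{2n}^{n-1}B_{n}}$, $\mathbf{D_{2n}^{n-1}C_{2n-2}}$, $\mathbf{D_{2n+1}^{n-1}B_{n-1}}$, $\mathbf{D_{2n+1}^{n-1}C_{2n-1}}$ with $n\ge3$. (ii) $X$ is not $F$-rational.
   Context: $F$-purity and $F$-rationality are in the usual sense of the theory of Frobenius splittings and tight closure. List (L) of labelled polynomials $f$: (1) $\mathbf{D_4^1B_1}$: $z^2+xyz+wx^2+y^3$; $\mathbf{D_4^1B_2}$: $z^2+xy^2+xyz+wx^2$; $\mathbf{D_4^0B_1}$: $z^2+wx^2+y^3$; $\mathbf{D_4^0B_2}$: $z^2+xy^2+wx^2$; $\mathbf{D_5^1C_3}$: $z^2+x^2y+y^2z+xyz+wy^3$; $\mathbf{D_5^0C_3}$: $z^2+x^2y+y^2z+wy^3$; $\mathbf{D_6^2B_2}$: $z^2+xy^3+xyz+wx^2+y^5$; $\mathbf{D_6^2B_3}$: $z^2+xy^3+xyz+wx^2$; $\mathbf{D_6^2C_4}$: $z^2+x^2y+xy^3+xyz+wy^4$; $\mathbf{D_6^1B_2}$: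 $z^2+xy^3+wx^2+y^5$; $\mathbf{D_6^1B_3}$: $z^2+xy^3+wx^2$; $\mathbf{D_6^1C_3}$: $z^2+x^2y+xy^3+xy^2z+wy^3$; $\mathbf{D_6^1C_4}$: $z^2+x^2y+xy^3+xy^2z+wy^4$; $\mathbf{D_6^0C_3}$: $z^2+x^2y+xy^3+wy^3$; $\mathbf{D_6^0C_4}$: $z^2+x^2y+xy^3+wy^4$; $\mathbf{D_7^2B_2}$: $z^2+xyz+wx^2+y^5$; $\mathbf{D_7^2C_5}$: $z^2+x^2y+y^3z+xyz+wy^5$; $\mathbf{D_7^1C_4}$: $z^2+x^2y+y^3z+xy^2z+wy^4$; $\mathbf{D_7^1C_5}$: $z^2+x^2y+y^3z+xy^2z+wy^5$; $\mathbf{D_7^0C_4}$: $z^2+x^2y+y^3z+wy^4$; $\mathbf{D_7^0C_5}$: $z^2+x^2y+y^3z+wy^5$. (2) For every integer $n\ge4$: (a) for integers $r$ with $n/2<r\le n-1$: $\mathbf{D_{2n}^{r}B_m}$ ($r\le m\le n-1$): $z^2+xy^n+xy^{n-r}z+wx^2+y^{2m+1}$; $\mathbf{D_{2n}^{r}B_n}$: $z^2+xy^n+xy^{n-r}z+wx^2$; $\mathbf{D_{2n}^{r}C_m}$ ($2r\le m\le2n-2$): $z^2+x^2y+xy^n+xy^{n-r}z+wy^m$; (b) for integers $r$ with $1\le r\le n/2$: $\mathbf{D_{2n}^{r}B_m}$ ($\lfloor\frac{n+1}{2}\rfloor\le m\le n-1$): $z^2+xy^n+xy^{n-r}z+wx^2+y^{2m+1}$;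 $\mathbf{D_{2n}^{r}B_n}$: $z^2+xy^n+xy^{n-r}z+wx^2$; $\mathbf{D_{2n}^{r}C_m}$ ($n\le m\le2n-2$): $z^2+x^2y+xy^n+xy^{n-r}z+wy^m$; (c) $\mathbf{D_{2n}^{0}B_m}$ ($n$ even, $n/2\le m\le n-1$): $z^2+xy^n+wx^2+y^{2m+1}$; $\mathbf{D_{2n}^{0}B_n}$ ($n$ even): $z^2+xy^n+wx^2$; $\mathbf{D_{2n}^{0}C_m}$ ($n\le m\le2n-2$): $z^2+x^2y+xy^n+wy^m$; (d) $\mathbf{D_{2n+1}^{n-1}B_{n-1}}$: $z^2+xyz+wx^2+y^{2n-1}$; (e) for integers $r$ with $n/2<r\le n-1$: $\mathbf{D_{2n+1}^{r}C_m}$ ($2r+1\le m\le2n-1$): $z^2+x^2y+y^nz+xy^{n-r}z+wy^m$; (f) for integers $r$ with $1\le r\le n/2$: $\mathbf{D_{2n+1}^{r}C_m}$ ($n+1\le m\le2n-1$): $z^2+x^2y+y^nz+xy^{n-r}z+wy^m$; (g) $\mathbf{D_{2n+1}^{0}C_m}$ ($n+1\le m\le2n-1$): $z^2+x^2y+y^nz+wy^m$. (3) $\mathbf{E_7^3F_4}$: $z^2+x^3+xy^3+xyz+wy^4$; $\mathbf{E_7^2F_4}$: $z^2+x^3+xy^3+y^3z+wy^4$; $\mathbf{E_7^1F_4}$: $z^2+x^3+xy^3+wy^4$; $\mathbf{E_8^3F_4}$: $z^2+x^3+y^3z+wy^4$; $\mathbf{E_8^2F_4}$: $z^2+x^3+xy^2z+wy^4$;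 $\mathbf{E_8^1F_4}$: $z^2+x^3+xy^3z+wy^4$; $\mathbf{E_8^0F_4}$: $z^2+x^3+wy^4$. In the labels $\mathbf{D_{2n}^{n-1}\cdot}$ and $\mathbf{D_{2n+1}^{n-1}\cdot}$ the case $n=3$ refers to the entries $\mathbf{D_6^2B_2}$, $\mathbf{D_6^2B_3}$, $\mathbf{D_6^2C_4}$, $\mathbf{D_7^2B_2}$, $\mathbf{D_7^2C_5}$ of part (1). *)

(* Defs.v *)
From HB Require Import structures.
From mathcomp Require Import all_boot all_algebra.
From mathcomp Require Import boolp classical_sets.
From mathcomp Require Import ring freeg mpoly.

Set Implicit Arguments.
Unset Strict Implicit.
Unset Printing Implicit Defensive.

Import GRing.Theory.

Local Open Scope ring_scope.
Local Open Scope quotient_scope.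
Local Open Scope classical_set_scope.

Section Ideals.
Variable A : comPzRingType.
Implicit Types (I Q : set A) (a b : A).

Definition ideal I : Prop :=
  [/\ I 0, forall a b, I a -> I b -> I (a + b) & forall a b, I b -> I (a * b)].

Definition ideal_gen (S : set A) : set A := smallest ideal S.

Definition prime_ideal Q : Prop :=
  [/\ ideal Q, ~ Q 1 & forall a b, Q (a * b) -> Q a \/ Q b].

Definition minimal_prime Q : Prop :=
  prime_ideal Q /\ forall Q', prime_ideal Q' -> Q' `<=` Q -> Q' = Q.

Record Spec := Point { pt : set A; pt_prime : prime_ideal pt }.

Definition prime_chain (d : nat) : Prop :=
  exists Q : nat -> set A,
    (forall i, (i <= d)%N -> prime_ideal (Q i)) /\
    (forall i, (i < d)%N -> Q i `<` Q i.+1).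

Definition krull_dim (d : nat) : Prop := prime_chain d /\ ~ prime_chain d.+1.

End Ideals.

Section Stalk.
Variables (A : comPzRingType) (x : Spec A).

(* the pair (a, s) stands for the fraction a / s *)
Definition frac := (A * {s : A | s \notin pt x})%type.
Implicit Types u v w : frac.

Definition frac_eq u v : bool :=
  `[< exists2 r, r \notin pt x & r * (u.1 * val v.2 - v.1 * val u.2) = 0 >].

Lemma notin_pt1 : (1 : A) \notin pt x.
Proof. by apply/negP; rewrite inE; case: (pt_prime x). Qed.

Lemma notin_ptM s t : s \notin pt x -> t \notin pt x -> s * t \notin pt x.
Proof.
move=> /negP s_x /negP t_x; apply/negP; rewrite inE => st_x.
by case: (pt_prime x) => _ _ /(_ _ _ st_x) [] h; [apply: s_x|apply: t_x];
  rewrite inE.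
Qed.

Lemma frac_eq_equiv : equiv_class_of frac_eq.
Proof.
split=> [u|u v|v u w].
- by apply/asboolP; exists 1; [exact: notin_pt1 | rewrite subrr mulr0].
- apply: asbool_equiv_eq; split=> -[r rx e]; exists r => //;
    by rewrite -opprB mulrN e oppr0.
- move=> /asboolP[r rx e] /asboolP[s sx h]; apply/asboolP.
  exists (r * s * val v.2); first by rewrite !notin_ptM // (valP v.2).
  transitivity (s * val w.2 * (r * (u.1 * val v.2 - v.1 * val u.2))
                + r * val u.2 * (s * (v.1 * val w.2 - w.1 * val v.2))).
    by ring.
  by rewrite e h !mulr0 addr0.
Qed.

Canonical frac_equiv := EquivRelPack frac_eq_equiv.
Canonical frac_encModRel := defaultEncModRel frac_eq.

Definition stalk := {eq_quot frac_eq}.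
HB.instance Definition _ : EqQuotient frac frac_eq stalk := EqQuotient.on stalk.
HB.instance Definition _ := Choice.on stalk.

Definition den1 : {s : A | s \notin pt x} := exist _ 1 notin_pt1.
Definition denM (s t : {s : A | s \notin pt x}) : {s : A | s \notin pt x} :=
  exist _ (val s * val t) (notin_ptM (valP s) (valP t)).

Definition frac0 : frac := (0, den1).
Definition frac1 : frac := (1, den1).
Definition frac_opp u : frac := (- u.1, u.2).
Definition frac_add u v : frac :=
  (u.1 * val v.2 + v.1 * val u.2, denM u.2 v.2).
Definition frac_mul u v : frac := (u.1 * v.1, denM u.2 v.2).

Lemma stalk_eqP u v :
  reflect (exists2 r, r \notin pt x & r * (u.1 * val v.2 - v.1 * val u.2) = 0)
          (u == v %[mod stalk]).
Proof. by rewrite piE; exact: asboolP. Qed.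

Definition stalk0 : stalk := \pi_stalk frac0.
Definition stalk1 : stalk := \pi_stalk frac1.
Definition stalk_opp (a : stalk) : stalk := \pi_stalk (frac_opp (repr a)).
Definition stalk_add (a b : stalk) : stalk := \pi_stalk (frac_add (repr a) (repr b)).
Definition stalk_mul (a b : stalk) : stalk := \pi_stalk (frac_mul (repr a) (repr b)).

Lemma pi_repr u : exists2 r, r \notin pt x
  & r * ((repr (\pi_stalk u)).1 * val u.2 - u.1 * val (repr (\pi_stalk u)).2) = 0.
Proof. by apply/stalk_eqP; rewrite reprK. Qed.

Lemma pi_stalk_opp u : stalk_opp (\pi_stalk u) = \pi_stalk (frac_opp u).
Proof.
apply/eqP/stalk_eqP; have [r rx e] := pi_repr u; exists r => //=.
by rewrite !mulNr -opprD mulrN e oppr0.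
Qed.

Lemma pi_stalk_add u v : stalk_add (\pi_stalk u) (\pi_stalk v) = \pi_stalk (frac_add u v).
Proof.
apply/eqP/stalk_eqP; have [r rx e] := pi_repr u; have [s sx h] := pi_repr v.
exists (r * s); first exact: notin_ptM.
rewrite /=; set u' := repr _ in e *; set v' := repr _ in h *.
transitivity (s * val v'.2 * val v.2 * (r * (u'.1 * val u.2 - u.1 * val u'.2))
            + r * val u'.2 * val u.2 * (s * (v'.1 * val v.2 - v.1 * val v'.2))).
  by rewrite /=; ring.
by rewrite e h !mulr0 addr0.
Qed.

Lemma pi_stalk_mul u v : stalk_mul (\pi_stalk u) (\pi_stalk v) = \pi_stalk (frac_mul u v).
Proof.
apply/eqP/stalk_eqP; have [r rx e] := pi_repr u; have [s sx h] := pi_repr v.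
exists (r * s); first exact: notin_ptM.
rewrite /=; set u' := repr _ in e *; set v' := repr _ in h *.
transitivity (s * v'.1 * val v.2 * (r * (u'.1 * val u.2 - u.1 * val u'.2))
            + r * u.1 * val u'.2 * (s * (v'.1 * val v.2 - v.1 * val v'.2))).
  by rewrite /=; ring.
by rewrite e h !mulr0 addr0.
Qed.

Lemma stalk_eq u v : u.1 * val v.2 = v.1 * val u.2 -> \pi_stalk u = \pi v.
Proof.
move=> e; apply/eqP/stalk_eqP; exists 1; first exact: notin_pt1.
by rewrite e subrr mulr0.
Qed.

Lemma stalk_addA : associative stalk_add.
Proof.
elim/quotW=> u; elim/quotW=> v; elim/quotW=> w.
rewrite (pi_stalk_add u v) (pi_stalk_add v w) !pi_stalk_add.
by apply: stalk_eq => /=; ring.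
Qed.

Lemma stalk_addC : commutative stalk_add.
Proof.
elim/quotW=> u; elim/quotW=> v; rewrite !pi_stalk_add.
by apply: stalk_eq => /=; ring.
Qed.

Lemma stalk_add0 : left_id stalk0 stalk_add.
Proof.
by elim/quotW=> u; rewrite pi_stalk_add; apply: stalk_eq => /=; ring.
Qed.

Lemma stalk_addN : left_inverse stalk0 stalk_opp stalk_add.
Proof.
by elim/quotW=> u; rewrite pi_stalk_opp pi_stalk_add; apply: stalk_eq => /=; ring.
Qed.

HB.instance Definition _ :=
  GRing.isZmodule.Build stalk stalk_addA stalk_addC stalk_add0 stalk_addN.

Lemma stalk_mulA : associative stalk_mul.
Proof.
elim/quotW=> u; elim/quotW=> v; elim/quotW=> w.
rewrite (pi_stalk_mul u v) (pi_stalk_mul v w) !pi_stalk_mul.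
by apply: stalk_eq => /=; ring.
Qed.

Lemma stalk_mulC : commutative stalk_mul.
Proof.
elim/quotW=> u; elim/quotW=> v; rewrite !pi_stalk_mul.
by apply: stalk_eq => /=; ring.
Qed.

Lemma stalk_mul1 : left_id stalk1 stalk_mul.
Proof.
by elim/quotW=> u; rewrite pi_stalk_mul; apply: stalk_eq => /=; ring.
Qed.

Lemma stalk_mulDl : left_distributive stalk_mul +%R.
Proof.
elim/quotW=> u; elim/quotW=> v; elim/quotW=> w.
rewrite /+%R /= (pi_stalk_add u v) (pi_stalk_mul u w) (pi_stalk_mul v w).
rewrite pi_stalk_add pi_stalk_mul.
by apply: stalk_eq => /=; ring.
Qed.

HB.instance Definition _ := GRing.Zmodule_isComPzRing.Build stalk
  stalk_mulA stalk_mulC stalk_mul1 stalk_mulDl.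

End Stalk.

Section FrobeniusTensor.
Variables (p : nat) (A : comPzRingType) (M : lmodType A).

(* The subgroup of relations defining F_* A (x)_A M, where r in A acts on F_* A
   as multiplication by r ^+ p. *)
Inductive tensor_rel : {freeg (A * M)%type / int} -> Prop :=
| TensorRel0 : tensor_rel 0
| TensorRelB u v : tensor_rel u -> tensor_rel v -> tensor_rel (u - v)
| TensorRelDl a b m :
    tensor_rel (<< (a + b, m) >> - << (a, m) >> - << (b, m) >>)
| TensorRelDr a m n :
    tensor_rel (<< (a, m + n) >> - << (a, m) >> - << (a, n) >>)
| TensorRelZ a r m : tensor_rel (<< (a * r ^+ p, m) >> - << (a, r *: m) >>).

Definition tensor_relb : pred {freeg (A * M)%type / int} :=
  fun u => `[< tensor_rel u >].

Lemma tensor_relb_closed : zmod_closed tensor_relb.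
Proof.
split; first by apply/asboolP; constructor.
by move=> u v /asboolP ? /asboolP ?; apply/asboolP; constructor.
Qed.

HB.instance Definition _ := GRing.isZmodClosed.Build _ tensor_relb tensor_relb_closed.

Definition Frob_tensor :=
  Quotient.quot (GRing.ZmodClosed.clone _ tensor_relb _).

Definition Frob_tensor_mk (a : A) (m : M) : Frob_tensor := \pi << (a, m) >>.

End FrobeniusTensor.

(* For a ring A of characteristic p: purity of the Frobenius map A -> F_* A. *)
Definition F_pure (p : nat) (A : comPzRingType) : Prop :=
  forall M : lmodType A, injective (@Frob_tensor_mk p A M 1).

Definition Spec_F_pure (p : nat) (A : comPzRingType) : Prop :=
  forall x : Spec A, F_pure p (stalk x).

Section TightClosure.
Variables (p : nat) (A : comPzRingType).
Implicit Types (I : set A) (s t : seq A).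

Definition frobenius_power I (q : nat) : set A :=
  ideal_gen [set a ^+ q | a in I].

Definition tight_closure I : set A :=
  [set a | exists c, (forall Q, minimal_prime Q -> ~ Q c) /\
     exists e0, forall e, (e0 <= e)%N ->
       frobenius_power I (p ^ e) (c * a ^+ (p ^ e))].

Definition tightly_closed I : Prop := tight_closure I = I.

(* For a local ring A, whose maximal ideal is the set of nonunits: s has dim A
   entries and generates an ideal primary to the maximal ideal. *)
Definition system_of_parameters s : Prop :=
  krull_dim A (size s) /\
  forall a, (~ exists b, b * a = 1) <-> exists n, ideal_gen [set` s] (a ^+ n).

Definition parameters s : Prop := exists t, system_of_parameters (s ++ t).

(* for a Noetherian local ring A of characteristic p *)
Definition F_rational : Prop :=
  forall s, parameters s -> tightly_closed (ideal_gen [set` s]).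

End TightClosure.

Definition Spec_F_rational (p : nat) (A : comPzRingType) : Prop :=
  forall x : Spec A, F_rational p (stalk x).

Section PrincipalQuotient.
Variables (S : comPzRingType) (f : S).

Definition principal : pred S := fun g => `[< exists h, g = h * f >].

Lemma principal_closed : zmod_closed principal.
Proof.
split; first by apply/asboolP; exists 0; rewrite mul0r.
move=> _ _ /asboolP[g ->] /asboolP[h ->]; apply/asboolP.
by exists (g - h); rewrite mulrBl.
Qed.

HB.instance Definition _ := GRing.isZmodClosed.Build S principal principal_closed.

Definition pquot := Quotient.quot (GRing.ZmodClosed.clone _ principal _).
HB.instance Definition _ := GRing.Zmodule.on pquot.
HB.instance Definition _ := EqQuotient.on pquot.

Lemma pquot_eqP g h : reflect (exists u, g - h = u * f) (g == h %[mod pquot]).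
Proof. by rewrite piE; exact: asboolP. Qed.

Definition pquot1 : pquot := \pi_pquot 1.
Definition pquot_mul (a b : pquot) : pquot := \pi_pquot (repr a * repr b).

Lemma pi_pquot_add g h : \pi_pquot (g + h) = \pi_pquot g + \pi_pquot h.
Proof. exact: Quotient.pi_add. Qed.

Lemma pi_pquot_mul g h : pquot_mul (\pi_pquot g) (\pi_pquot h) = \pi_pquot (g * h).
Proof.
have r k : exists u, repr (\pi_pquot k) - k = u * f.
  by apply/pquot_eqP; rewrite reprK.
apply/eqP/pquot_eqP; have [u e] := r g; have [v e'] := r h.
set g' := repr _ in e *; set h' := repr _ in e' *.
exists (u * h' + g * v).
transitivity ((g' - g) * h' + g * (h' - h)); first by ring.
by rewrite e e'; ring.
Qed.

Lemma pquot_mulA : associative pquot_mul.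
Proof.
elim/quotW=> a; elim/quotW=> b; elim/quotW=> c.
rewrite (pi_pquot_mul a b) (pi_pquot_mul b c) pi_pquot_mul (pi_pquot_mul (a * b)).
by rewrite mulrA.
Qed.

Lemma pquot_mulC : commutative pquot_mul.
Proof.
by elim/quotW=> a; elim/quotW=> b; rewrite (pi_pquot_mul a) (pi_pquot_mul b) mulrC.
Qed.

Lemma pquot_mul1 : left_id pquot1 pquot_mul.
Proof. by elim/quotW=> a; rewrite pi_pquot_mul mul1r. Qed.

Lemma pquot_mulDl : left_distributive pquot_mul +%R.
Proof.
elim/quotW=> a; elim/quotW=> b; elim/quotW=> c.
rewrite -pi_pquot_add (pi_pquot_mul (a + b)) (pi_pquot_mul a c) (pi_pquot_mul b c).
by rewrite -pi_pquot_add mulrDl.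
Qed.

HB.instance Definition _ := GRing.Zmodule_isComPzRing.Build pquot
  pquot_mulA pquot_mulC pquot_mul1 pquot_mulDl.

End PrincipalQuotient.

(* [DB N r m], [DC N r m] and [EF N r] are the labels D_N^r B_m, D_N^r C_m
   and E_N^r F_4. *)
Inductive label :=
| DB of nat & nat & nat
| DC of nat & nat & nat
| EF of nat & nat.

Section Listed.
Variable k : closedFieldType.

Local Notation x := ('X_(@Ordinal 4 0 isT) : {mpoly k[4]}).
Local Notation y := ('X_(@Ordinal 4 1 isT) : {mpoly k[4]}).
Local Notation z := ('X_(@Ordinal 4 2 isT) : {mpoly k[4]}).
Local Notation w := ('X_(@Ordinal 4 3 isT) : {mpoly k[4]}).

Inductive listed : label -> {mpoly k[4]} -> Prop :=
| L_D4_1_B1 : listed (DB 4 1 1) (z^+2 + x*y*z + w*x^+2 + y^+3)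
| L_D4_1_B2 : listed (DB 4 1 2) (z^+2 + x*y^+2 + x*y*z + w*x^+2)
| L_D4_0_B1 : listed (DB 4 0 1) (z^+2 + w*x^+2 + y^+3)
| L_D4_0_B2 : listed (DB 4 0 2) (z^+2 + x*y^+2 + w*x^+2)
| L_D5_1_C3 : listed (DC 5 1 3) (z^+2 + x^+2*y + y^+2*z + x*y*z + w*y^+3)
| L_D5_0_C3 : listed (DC 5 0 3) (z^+2 + x^+2*y + y^+2*z + w*y^+3)
| L_D6_2_B2 : listed (DB 6 2 2) (z^+2 + x*y^+3 + x*y*z + w*x^+2 + y^+5)
| L_D6_2_B3 : listed (DB 6 2 3) (z^+2 + x*y^+3 + x*y*z + w*x^+2)
| L_D6_2_C4 : listed (DC 6 2 4) (z^+2 + x^+2*y + x*y^+3 + x*y*z + w*y^+4)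
| L_D6_1_B2 : listed (DB 6 1 2) (z^+2 + x*y^+3 + w*x^+2 + y^+5)
| L_D6_1_B3 : listed (DB 6 1 3) (z^+2 + x*y^+3 + w*x^+2)
| L_D6_1_C3 : listed (DC 6 1 3) (z^+2 + x^+2*y + x*y^+3 + x*y^+2*z + w*y^+3)
| L_D6_1_C4 : listed (DC 6 1 4) (z^+2 + x^+2*y + x*y^+3 + x*y^+2*z + w*y^+4)
| L_D6_0_C3 : listed (DC 6 0 3) (z^+2 + x^+2*y + x*y^+3 + w*y^+3)
| L_D6_0_C4 : listed (DC 6 0 4) (z^+2 + x^+2*y + x*y^+3 + w*y^+4)
| L_D7_2_B2 : listed (DB 7 2 2) (z^+2 + x*y*z + w*x^+2 + y^+5)
| L_D7_2_C5 : listed (DC 7 2 5) (z^+2 + x^+2*y + y^+3*z + x*y*z + w*y^+5)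
| L_D7_1_C4 : listed (DC 7 1 4) (z^+2 + x^+2*y + y^+3*z + x*y^+2*z + w*y^+4)
| L_D7_1_C5 : listed (DC 7 1 5) (z^+2 + x^+2*y + y^+3*z + x*y^+2*z + w*y^+5)
| L_D7_0_C4 : listed (DC 7 0 4) (z^+2 + x^+2*y + y^+3*z + w*y^+4)
| L_D7_0_C5 : listed (DC 7 0 5) (z^+2 + x^+2*y + y^+3*z + w*y^+5)
| L_2a_B n r m of (4 <= n)%N & (n < 2 * r)%N & (r <= n - 1)%N &
    (r <= m)%N & (m <= n - 1)%N :
    listed (DB (2 * n) r m)
      (z^+2 + x*y^+n + x*y^+(n - r)*z + w*x^+2 + y^+(2 * m + 1))
| L_2a_Bn n r of (4 <= n)%N & (n < 2 * r)%N & (r <= n - 1)%N :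
    listed (DB (2 * n) r n) (z^+2 + x*y^+n + x*y^+(n - r)*z + w*x^+2)
| L_2a_C n r m of (4 <= n)%N & (n < 2 * r)%N & (r <= n - 1)%N &
    (2 * r <= m)%N & (m <= 2 * n - 2)%N :
    listed (DC (2 * n) r m)
      (z^+2 + x^+2*y + x*y^+n + x*y^+(n - r)*z + w*y^+m)
| L_2b_B n r m of (4 <= n)%N & (1 <= r)%N & (2 * r <= n)%N &
    ((n + 1) %/ 2 <= m)%N & (m <= n - 1)%N :
    listed (DB (2 * n) r m)
      (z^+2 + x*y^+n + x*y^+(n - r)*z + w*x^+2 + y^+(2 * m + 1))
| L_2b_Bn n r of (4 <= n)%N & (1 <= r)%N & (2 * r <= n)%N :
    listed (DB (2 * n) r n) (z^+2 + x*y^+n + x*y^+(n - r)*z + w*x^+2)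
| L_2b_C n r m of (4 <= n)%N & (1 <= r)%N & (2 * r <= n)%N &
    (n <= m)%N & (m <= 2 * n - 2)%N :
    listed (DC (2 * n) r m)
      (z^+2 + x^+2*y + x*y^+n + x*y^+(n - r)*z + w*y^+m)
| L_2c_B n m of (4 <= n)%N & ~~ odd n & (n <= 2 * m)%N & (m <= n - 1)%N :
    listed (DB (2 * n) 0 m) (z^+2 + x*y^+n + w*x^+2 + y^+(2 * m + 1))
| L_2c_Bn n of (4 <= n)%N & ~~ odd n :
    listed (DB (2 * n) 0 n) (z^+2 + x*y^+n + w*x^+2)
| L_2c_C n m of (4 <= n)%N & (n <= m)%N & (m <= 2 * n - 2)%N :
    listed (DC (2 * n) 0 m) (z^+2 + x^+2*y + x*y^+n + w*y^+m)
| L_2d n of (4 <= n)%N :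
    listed (DB (2 * n + 1) (n - 1) (n - 1))
      (z^+2 + x*y*z + w*x^+2 + y^+(2 * n - 1))
| L_2e n r m of (4 <= n)%N & (n < 2 * r)%N & (r <= n - 1)%N &
    (2 * r + 1 <= m)%N & (m <= 2 * n - 1)%N :
    listed (DC (2 * n + 1) r m)
      (z^+2 + x^+2*y + y^+n*z + x*y^+(n - r)*z + w*y^+m)
| L_2f n r m of (4 <= n)%N & (1 <= r)%N & (2 * r <= n)%N &
    (n + 1 <= m)%N & (m <= 2 * n - 1)%N :
    listed (DC (2 * n + 1) r m)
      (z^+2 + x^+2*y + y^+n*z + x*y^+(n - r)*z + w*y^+m)
| L_2g n m of (4 <= n)%N & (n + 1 <= m)%N & (m <= 2 * n - 1)%N :
    listed (DC (2 * n + 1) 0 m) (z^+2 + x^+2*y + y^+n*z + w*y^+m)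
| L_E7_3 : listed (EF 7 3) (z^+2 + x^+3 + x*y^+3 + x*y*z + w*y^+4)
| L_E7_2 : listed (EF 7 2) (z^+2 + x^+3 + x*y^+3 + y^+3*z + w*y^+4)
| L_E7_1 : listed (EF 7 1) (z^+2 + x^+3 + x*y^+3 + w*y^+4)
| L_E8_3 : listed (EF 8 3) (z^+2 + x^+3 + y^+3*z + w*y^+4)
| L_E8_2 : listed (EF 8 2) (z^+2 + x^+3 + x*y^+2*z + w*y^+4)
| L_E8_1 : listed (EF 8 1) (z^+2 + x^+3 + x*y^+3*z + w*y^+4)
| L_E8_0 : listed (EF 8 0) (z^+2 + x^+3 + w*y^+4).

End Listed.

(* Main.v *)
From HB Require Import structures.
From mathcomp Require Import all_boot all_algebra.
From mathcomp Require Import boolp classical_sets.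
From mathcomp Require Import ring zify freeg mpoly.
Require Import Defs.

(** Write S = k[x,y,z,w]. Every listed f has the form
      z^2 + c xyz + alpha x^2 + beta y^2   with c = 0 or c = 1,
    and c = 1 exactly for the labels in (i).

    If c = 1, the coefficient of xyzw in f w, relative to the basis of squarefree
    monomials of S over S^2, is 1. Hence g |-> C(f w g), with C the Cartier operator,
    is a splitting of Frobenius on S that preserves (f), and it induces splittings on
    all local rings of X (Fedder's criterion). C(g) is the square root of the mixed
    derivative d^4 g / dx dy dz dw.

    At the origin put I = (x, y, w). Then z is not in I, as f becomes z^2 modulo I. If
    c = 0 then z^2 lies in the Frobenius power I^[2], so the local ring is not F-pure.
    For any c, iterating the equation gives z^q in ((xy)^(q-1) z, x^q, y^q), hence
    x z^q is in I^[q] for all q = 2^e and z is in the tight closure of I. It remains to see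
    that x, y, w are parameters and that x is in no minimal prime: f = v^m w + g with v = x
    or v = y and g free of w, which makes (f) prime, and the dimension is 3 because
    n + 1 elements of a polynomial ring in n variables are algebraically dependent. *)

Set Implicit Arguments.
Unset Strict Implicit.
Unset Printing Implicit Defensive.

Import GRing.Theory.

Local Open Scope ring_scope.
Local Open Scope quotient_scope.
Local Open Scope classical_set_scope.

(** * Frobenius splittings and purity *)

Section FrobeniusSplitting.
Variable p : nat.

Definition Frob_splitting (A : comPzRingType) (phi : A -> A) : Prop :=
  [/\ phi 1 = 1, {morph phi : a b / a - b} &
      forall a b, phi (a * b ^+ p) = phi a * b].

(** A splitting makes [a (x) m |-> phi a *: m] a well-defined additive map from [F_* A (x) M] to
    [M], and this map is a left inverse of [m |-> 1 (x) m]. It is built on the free group and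
    checked on the generating relations. *)
Lemma Frob_splitting_pure (A : comPzRingType) (phi : A -> A) :
  Frob_splitting phi -> F_pure p A.
Proof.
case=> phi1 phiB phiZ M m n.
have phi0 : phi 0 = 0 by have := phiB 0 0; rewrite !subrr.
have phiD a b : phi (a + b) = phi a + phi b.
  by rewrite -[b in LHS]opprK -[- b]sub0r !phiB phi0 sub0r opprK.
pose F : {freeg (A * M)%type / int} -> zmodule M := fglift (fun u => phi u.1 *: u.2 : zmodule M).
have FU u : F << u >> = phi u.1 *: u.2 by rewrite /F liftU scale1r.
have FB u v : F (u - v) = F u - F v by apply: lift_is_additive.
have F0 : F 0 = 0 by have := FB 0 0; rewrite !subrr.
have Frel u : tensor_rel p u -> F u = 0.
  elim=> [|u1 u2 _ e1 _ e2|a b l|a l1 l2|a r l] //.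
  - by rewrite FB e1 e2 subr0.
  - by rewrite !FB !FU /= phiD scalerDl -addrA -opprD subrr.
  - by rewrite !FB !FU /= scalerDr -addrA -opprD subrr.
  - by rewrite !FB !FU /= phiZ scalerA subrr.
rewrite /Frob_tensor_mk => /eqP; rewrite -Quotient.idealrBE => /asboolP /Frel.
by rewrite FB !FU /= phi1 !scale1r => /eqP; rewrite subr_eq0 => /eqP.
Qed.

Lemma Frob_splitting_pquot (S : comPzRingType) (f : S) (phi : S -> S) :
  phi 1 = 1 -> {morph phi : a b / a - b} ->
  (forall a b, phi (a * b ^+ p) = phi a * b) ->
  (forall a, exists b, phi (a * f) = b * f) ->
  Frob_splitting (fun a : pquot f => \pi_(pquot f) (phi (repr a))).
Proof.
move=> phi1 phiB phiZ phif.
have E g : \pi_(pquot f) (phi (repr (\pi_(pquot f) g))) = \pi_(pquot f) (phi g).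
  apply/eqP/pquot_eqP; have /pquot_eqP[u e] : repr (\pi_(pquot f) g) == g %[mod pquot f].
    by rewrite reprK.
  by rewrite -phiB e.
have piX (g : S) n : (\pi_(pquot f) g) ^+ n = \pi_(pquot f) (g ^+ n).
  by elim: n => // n IH; rewrite !exprS IH; exact: pi_pquot_mul.
split.
- by rewrite [1]/(pquot1 f) /pquot1 E phi1.
- elim/quotW=> a; elim/quotW=> b.
  have piB (g h : S) : \pi_(pquot f) g - \pi h = \pi_(pquot f) (g - h).
    by rewrite Quotient.pi_add Quotient.pi_opp.
  by rewrite piB !E phiB piB.
- elim/quotW=> a; elim/quotW=> b.
  by rewrite piX [_ * _]pi_pquot_mul !E phiZ -pi_pquot_mul.
Qed.

End FrobeniusSplitting.

Section LocalizedSplitting.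
Variables (p : nat) (A : comPzRingType) (phi : A -> A) (x : Spec A).
Hypotheses (p_gt0 : (0 < p)%N) (phiP : Frob_splitting p phi).

(** The fraction [a / s] equals [a s^(p-1) / s^p], and [phi] must take the denominator [s^p] out as
    [s]. *)
Definition split_frac (u : frac x) : frac x :=
  (phi (u.1 * val u.2 ^+ p.-1), u.2).

Definition split_stalk (a : stalk x) : stalk x := \pi_(stalk x) (split_frac (repr a)).

Lemma pi_split_stalk u : split_stalk (\pi_(stalk x) u) = \pi_(stalk x) (split_frac u).
Proof.
case: phiP => phi1 phiB phiZ.
apply/eqP/stalk_eqP; have [r rx e] := pi_repr u; exists r => //=.
set v := repr _ in e *; case: u v e => a [s ?] [b [t ?]] /= e.
(* Factors outside [phi] enter it as p-th powers; the single argument that results is a multiple of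
   [r * (b * s - a * t)], which is 0. *)
rewrite mulrC mulrBl -!mulrA -!phiZ -phiB.
have -> : b * t ^+ p.-1 * (s * r) ^+ p - a * s ^+ p.-1 * (t * r) ^+ p
   = r ^+ p * (t * s) ^+ p.-1 * (b * s - a * t).
  by case: p p_gt0 => // q _; rewrite /= !exprMn !exprS; ring.
case: p p_gt0 phiZ => // q _ phiZ /=.
rewrite exprS; have -> : r * r ^+ q * (t * s) ^+ q * (b * s - a * t) =
  r ^+ q * (t * s) ^+ q * (r * (b * s - a * t)) by ring.
by rewrite e mulr0; have := phiB 0 0; rewrite !subrr.
Qed.

Lemma Frob_splitting_stalk : Frob_splitting p split_stalk.
Proof.
case: (phiP) => phi1 phiB phiZ.
have piB u v : \pi_(stalk x) u - \pi_(stalk x) v = \pi_(stalk x) (frac_add u (frac_opp v)).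
  rewrite -[RHS]pi_stalk_add; congr (_ + _); exact: pi_stalk_opp.
have piX a (s : {s : A | s \notin pt x}) n : exists t : {s : A | s \notin pt x},
    val t = val s ^+ n /\ (\pi_(stalk x) (a, s)) ^+ n = \pi_(stalk x) (a ^+ n, t).
  elim: n => [|n [t [tE aE]]]; first by exists (den1 x).
  exists (denM s t); rewrite /= exprS tE; split => //.
  by rewrite exprS aE [LHS]pi_stalk_mul /frac_mul /= -exprS.
split.
- rewrite [1]/(stalk1 x) /stalk1 pi_split_stalk; apply: stalk_eq.
  by rewrite /= expr1n !mulr1 phi1.
- elim/quotW=> -[a s]; elim/quotW=> -[b t].
  rewrite piB !pi_split_stalk piB; apply: stalk_eq; case: s t => s ? [t ?] /=.
  congr (_ * (s * t)); rewrite !mulNr -[phi _ * t]phiZ -[phi _ * s]phiZ -phiB; congr phi.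
  by case: p p_gt0 => // q _; rewrite /= !exprMn !exprS; ring.
- elim/quotW=> -[a s]; elim/quotW=> -[b t].
  have [t' [t'E ->]] := piX b t p.
  rewrite [_ * \pi_(stalk x) (b ^+ p, _)]pi_stalk_mul !pi_split_stalk [RHS]pi_stalk_mul.
  apply: stalk_eq; case: s t t' t'E => s ? [t ?] [t' ?] /= ->.
  have -> : a * b ^+ p * (s * t ^+ p) ^+ p.-1 = a * s ^+ p.-1 * (b * t ^+ p.-1) ^+ p.
    by rewrite !exprMn -!exprM [(p.-1 * p)%N]mulnC; ring.
  rewrite phiZ; case: p p_gt0 => // q _; rewrite /= exprS; ring.
Qed.

End LocalizedSplitting.

(** * The module [A / I] and its use as a test for purity *)

Section IdealQuotient.
Variables (A : comPzRingType) (I : set A).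

(** The proof that [I] is an ideal is a parameter, so that closure under subtraction can be attached
    to the predicate as a canonical instance. *)
Definition ideal_pred (I_ideal : ideal I) : pred A := fun a => `[< I a >].

Variable I_ideal : ideal I.

Lemma ideal_pred_closed : zmod_closed (ideal_pred I_ideal).
Proof.
case: (I_ideal) => I0 ID IM; split; first exact/asboolP.
by move=> a b /asboolP Ia /asboolP Ib; apply/asboolP; rewrite -mulN1r; apply: ID (IM _ _ Ib).
Qed.

HB.instance Definition _ :=
  GRing.isZmodClosed.Build A (ideal_pred I_ideal) ideal_pred_closed.

Definition ideal_quot := Quotient.quot (GRing.ZmodClosed.clone _ (ideal_pred I_ideal) _).
HB.instance Definition _ := GRing.Zmodule.on ideal_quot.
HB.instance Definition _ := EqQuotient.on ideal_quot.

Lemma ideal_quot_eqP a b : reflect (I (a - b)) (a == b %[mod ideal_quot]).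
Proof. by rewrite piE; exact: asboolP. Qed.

Definition ideal_quot_scale (a : A) (m : ideal_quot) : ideal_quot :=
  \pi_ideal_quot (a * repr m).

Lemma pi_ideal_quot_scale a b :
  ideal_quot_scale a (\pi_ideal_quot b) = \pi_ideal_quot (a * b).
Proof.
case: (I_ideal) => _ _ IM; apply/eqP/ideal_quot_eqP; rewrite -mulrBr; apply: IM.
by apply/ideal_quot_eqP; rewrite reprK.
Qed.

Lemma pi_ideal_quotD a b :
  \pi_ideal_quot a + \pi_ideal_quot b = \pi_ideal_quot (a + b).
Proof. by rewrite Quotient.pi_add. Qed.

Lemma pi_ideal_quot0 : \pi_ideal_quot 0 = 0.
Proof.
by have := pi_ideal_quotD 0 0; rewrite addr0 -[RHS]addr0 => /addrI.
Qed.

Lemma ideal_quot_scaleA a b m :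
  ideal_quot_scale a (ideal_quot_scale b m) = ideal_quot_scale (a * b) m.
Proof.
move: m; elim/quotW=> c.
by rewrite (pi_ideal_quot_scale b c) !pi_ideal_quot_scale mulrA.
Qed.

Lemma ideal_quot_scale1 : left_id 1 ideal_quot_scale.
Proof. by elim/quotW=> c; rewrite pi_ideal_quot_scale mul1r. Qed.

Lemma ideal_quot_scaleDr : right_distributive ideal_quot_scale +%R.
Proof.
move=> a; elim/quotW=> b; elim/quotW=> c.
by rewrite pi_ideal_quotD !pi_ideal_quot_scale mulrDr -pi_ideal_quotD.
Qed.

Lemma ideal_quot_scaleDl m :
  {morph ideal_quot_scale^~ m : a b / a + b}.
Proof.
move=> a b; move: m; elim/quotW=> c.
by rewrite !pi_ideal_quot_scale mulrDl -pi_ideal_quotD.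
Qed.

HB.instance Definition _ := GRing.Zmodule_isLmodule.Build A ideal_quot
  ideal_quot_scaleA ideal_quot_scale1 ideal_quot_scaleDr ideal_quot_scaleDl.

End IdealQuotient.

Lemma ideal_gen_ideal (A : comPzRingType) (S : set A) : ideal (ideal_gen S).
Proof.
split=> [J|a b Sa Sb J|a b Sb J] /[dup] hJ [] [J0 JD JM] _ //.
- by apply: JD; [apply: Sa | apply: Sb].
- by apply: JM; apply: Sb.
Qed.

Lemma ideal_gen_sub (A : comPzRingType) (S J : set A) :
  ideal J -> S `<=` J -> ideal_gen S `<=` J.
Proof. by move=> J_ideal SJ a; apply; split. Qed.

Lemma sub_ideal_gen (A : comPzRingType) (S : set A) : S `<=` ideal_gen S.
Proof. by move=> a Sa J [_ SJ]; apply: SJ. Qed.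

(* Purity tested on the module A / I: the map F_*A -> F_*A (x) A / I kills I^[p]. *)
Lemma F_pure_frobenius_power (p : nat) (A : comPzRingType) (I : set A) (a : A) :
  F_pure p A -> ideal I -> frobenius_power I p (a ^+ p) -> I a.
Proof.
move=> pureA I_ideal Iap; set M := ideal_quot I_ideal.
pose mk b (m : M) := Frob_tensor_mk p b m.
have mkB b c m n : tensor_rel p (<< (b, m) >> - << (c, n) >>) -> mk b m = mk c n.
  by move=> h; apply/eqP; rewrite -Quotient.idealrBE; apply/asboolP.
have mkDl b c m : mk (b + c) m = mk b m + mk c m.
  rewrite /mk /Frob_tensor_mk -[RHS]Quotient.pi_add; apply/eqP.
  rewrite -Quotient.idealrBE opprD addrA; apply/asboolP; exact: TensorRelDl.
have mk0l m : mk 0 m = 0.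
  by have := mkDl 0 0 m; rewrite addr0 -[LHS]addr0 => /addrI.
have mkDr b m n : mk b (m + n) = mk b m + mk b n.
  rewrite /mk /Frob_tensor_mk -[RHS]Quotient.pi_add; apply/eqP.
  rewrite -Quotient.idealrBE opprD addrA; apply/asboolP; exact: TensorRelDr.
have mk0r b : mk b 0 = 0.
  by have := mkDr b 0 0; rewrite addr0 -[LHS]addr0 => /addrI.
have mkZ b r m : mk (b * r ^+ p) m = mk b (r *: m) by apply: mkB; exact: TensorRelZ.
pose one : M := \pi_M 1.
have scale1 b : b *: one = \pi_M b.
  by rewrite [LHS](pi_ideal_quot_scale I_ideal b 1) mulr1.
(* The annihilator of [1 (x) 1]; quantifying over [c] makes the ideal property direct. It contains
   [b^p] for [b] in [I], since [c b^p (x) 1 = c (x) b = 0]. *)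
pose J : set A := [set b | forall c, mk (c * b) one = 0].
have J_ideal : ideal J.
  split=> [c|b c Jb Jc d|b c Jc d]; first by rewrite mulr0 mk0l.
  - by rewrite mulrDr mkDl Jb Jc addr0.
  - by rewrite mulrA Jc.
have {Iap} : J (a ^+ p).
  apply: ideal_gen_sub J_ideal _ _ Iap => _ [b Ib <-] c.
  rewrite mkZ scale1; have -> : \pi_M b = 0 :> M; last exact: mk0r.
  by rewrite -(pi_ideal_quot0 I_ideal); apply/eqP/ideal_quot_eqP; rewrite subr0.
move=> /(_ 1); rewrite mkZ scale1 -(mk0r 1) => /pureA e.
have : \pi_M a == \pi_M 0 by rewrite e pi_ideal_quot0.
by move/ideal_quot_eqP; rewrite subr0.
Qed.

(** * The Cartier operator in characteristic two *)

Section CharacteristicTwo.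
Variable A : comNzRingType.
Hypothesis char_A : 2%N \in [pchar A].
Implicit Types a b : A.

Lemma sqrrD_pchar2 a b : (a + b) ^+ 2 = a ^+ 2 + b ^+ 2.
Proof. by rewrite sqrrD addrAC mulr2n (addrr_pchar2 char_A) addr0. Qed.

Lemma sqrrB_pchar2 a b : (a - b) ^+ 2 = a ^+ 2 - b ^+ 2.
Proof. by rewrite !(oppr_pchar2 char_A) sqrrD_pchar2. Qed.

End CharacteristicTwo.

Lemma sqrr_inj_pchar2 (A : idomainType) :
  2%N \in [pchar A] -> injective (fun a : A => a ^+ 2).
Proof.
move=> char_A a b /eqP; rewrite -subr_eq0 -sqrrB_pchar2 // sqrf_eq0 subr_eq0.
by move/eqP.
Qed.

Lemma mpoly_ring_ind (n : nat) (R : nzRingType) (P : {mpoly R[n]} -> Prop) :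
  (forall c, P c%:MP) -> (forall i, P 'X_i) ->
  (forall p q, P p -> P q -> P (p + q)) ->
  (forall p q, P p -> P q -> P (p * q)) -> forall p, P p.
Proof.
move=> PC PX PD PM; elim/mpolyind => [|c m p _ _ Pp]; first by rewrite -mpolyC0.
apply: (PD) => //; rewrite -mul_mpolyC; apply: (PM) => //; rewrite mpolyXE_id.
elim/big_ind: _ => [||i _]; [by rewrite -mpolyC1 | exact: PM |].
by elim: (m i) => [|j IH]; [rewrite expr0 -mpolyC1|rewrite exprS; apply: (PM)].
Qed.

Section MpolyCharacteristicTwo.
Variables (n : nat) (R : comNzRingType).
Hypothesis char_R : 2%N \in [pchar R].

Lemma mpoly_pchar2 : 2%N \in [pchar {mpoly R[n]}].
Proof. exact: rmorph_pchar (@mpolyC n R) _ char_R. Qed.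

Lemma mderivM_sqr i (p q : {mpoly R[n]}) :
  (p * q ^+ 2)^`M(i) = p^`M(i) * q ^+ 2.
Proof.
rewrite mderivM expr2 mderivM (mulrC q q^`M(i)) (addrr_pchar2 mpoly_pchar2).
by rewrite mulr0 addr0.
Qed.

End MpolyCharacteristicTwo.

Lemma prod_ord4 (R : comPzRingType) (F : 'I_4 -> R) :
  \prod_(i < 4) F i = F (@Ordinal 4 0 isT) * F (@Ordinal 4 1 isT)
                   * F (@Ordinal 4 2 isT) * F (@Ordinal 4 3 isT).
Proof.
rewrite 4!big_ord_recr big_ord0 /= mul1r.
by congr (F _ * F _ * F _ * F _); exact: val_inj.
Qed.

Section CartierOperator.
Variable k : closedFieldType.
Hypothesis char_k : 2%N \in [pchar k].

Local Notation S := {mpoly k[4]}.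
Local Notation i0 := (@Ordinal 4 0 isT).
Local Notation i1 := (@Ordinal 4 1 isT).
Local Notation i2 := (@Ordinal 4 2 isT).
Local Notation i3 := (@Ordinal 4 3 isT).
Local Notation x := ('X_i0 : S).
Local Notation y := ('X_i1 : S).
Local Notation z := ('X_i2 : S).
Local Notation w := ('X_i3 : S).

Let char_S : 2%N \in [pchar S] := mpoly_pchar2 4 char_k.

Lemma mderivXU i j : ('X_j : S)^`M(i) = (i == j)%:R.
Proof.
rewrite mderivX mnm1E eq_sym; case: eqP => [->|_]; last by rewrite scale0r.
by rewrite scale1r -mpolyX0; congr 'X_[_]; apply/mnmP => l; rewrite mnmBE subnn mnm0E.
Qed.

Lemma mderiv4E :
  ((1 : S)^`M(i0) = 0) * ((1 : S)^`M(i1) = 0) * ((1 : S)^`M(i2) = 0) * ((1 : S)^`M(i3) = 0) *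
  ((x^`M(i0) = 1) * (x^`M(i1) = 0) * (x^`M(i2) = 0) * (x^`M(i3) = 0)) *
  ((y^`M(i0) = 0) * (y^`M(i1) = 1) * (y^`M(i2) = 0) * (y^`M(i3) = 0)) *
  ((z^`M(i0) = 0) * (z^`M(i1) = 0) * (z^`M(i2) = 1) * (z^`M(i3) = 0)) *
  ((w^`M(i0) = 0) * (w^`M(i1) = 0) * (w^`M(i2) = 0) * (w^`M(i3) = 1)).
Proof.
have D1 i : (1 : S)^`M(i) = 0 by rewrite -mpolyC1 mderivC.
by rewrite !mderivXU !D1.
Qed.

Definition mderiv_all (p : S) : S := p^`M(i0)^`M(i1)^`M(i2)^`M(i3).

Lemma mderiv_allD : {morph mderiv_all : p q / p + q}.
Proof. by move=> p q; rewrite /mderiv_all !mderivD. Qed.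

Lemma mderiv_allB : {morph mderiv_all : p q / p - q}.
Proof. by move=> p q; rewrite /mderiv_all !mderivB. Qed.

Lemma mderiv_all_sqr p q : mderiv_all (p * q ^+ 2) = mderiv_all p * q ^+ 2.
Proof. by rewrite /mderiv_all !mderivM_sqr. Qed.

(** Each term is a squarefree monomial times a square, its coefficient having a square root in the
    algebraically closed field. Squares are constants for the derivations, and sums of squares are
    squares. *)
Lemma mderiv_all_is_sqr p : exists q, mderiv_all p = q ^+ 2.
Proof.
elim/mpolyind: p => [|c m p _ _ [q pE]].
  by exists 0; rewrite /mderiv_all !mderiv0 expr0n.
rewrite mderiv_allD pE.
suff [q' ->] : exists q', mderiv_all (c *: 'X_[m]) = q' ^+ 2.
  by exists (q' + q); rewrite sqrrD_pchar2.
have [r rE] : exists r, r ^+ 2 = c.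
  have [r rE] := @solve_monicpoly k 2 (fun i => if i == 0%N then c else 0) isT.
  by exists r; rewrite rE !big_ord_recr big_ord0 /= mul0r addr0 add0r mulr1.
pose half i := 'X_i ^+ (m i)./2 : S.
have mE i : ('X_i : S) ^+ m i = 'X_i ^+ odd (m i) * half i ^+ 2.
  by rewrite -[in LHS](odd_double_half (m i)) exprD -exprM muln2.
have -> : c *: 'X_[m] = x ^+ odd (m i0) * y ^+ odd (m i1) * z ^+ odd (m i2)
    * w ^+ odd (m i3) * (r%:MP * (half i0 * half i1 * half i2 * half i3)) ^+ 2.
  rewrite -mul_mpolyC -rE mpolyXE_id prod_ord4 rmorphXn /= !mE !exprMn.
  move: (half _) (half _) (half _) (half _) => a0 a1 a2 a3.
  move: (_ ^+ odd _) (_ ^+ odd _) (_ ^+ odd _) (_ ^+ odd _) => b0 b1 b2 b3.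
  by move: (r%:MP) => r'; ring.
rewrite mderiv_all_sqr.
set g := _ * _ * _ * w ^+ _.
(* [g] is a squarefree monomial: the value is 1 for [x y z w] and 0 for the other fifteen. *)
have [-> | ->] : mderiv_all g = 0 \/ mderiv_all g = 1.
  rewrite /g /mderiv_all; do 4! case: (odd _); rewrite ?expr1 ?expr0 ?mulr1 ?mul1r;
    rewrite !(mderivM, mderiv4E, mderiv0, mulr0, mul0r, mulr1, mul1r, addr0, add0r);
    by [left | right].
- by exists 0; rewrite mul0r expr0n.
- by rewrite mul1r; eexists.
Qed.

(** Square roots in [S] are unique in characteristic two, so the choice is determined, and
    identities for [Cartier] can be checked after squaring. *)
Definition Cartier (p : S) : S := projT1 (cid (mderiv_all_is_sqr p)).

Lemma Cartier_sqr p : Cartier p ^+ 2 = mderiv_all p.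
Proof. by rewrite /Cartier; case: cid. Qed.

Lemma CartierB : {morph Cartier : p q / p - q}.
Proof.
move=> p q; apply: (sqrr_inj_pchar2 char_S) => /=.
by rewrite sqrrB_pchar2 // !Cartier_sqr mderiv_allB.
Qed.

Lemma Cartier_sqrM p q : Cartier (p * q ^+ 2) = Cartier p * q.
Proof.
apply: (sqrr_inj_pchar2 char_S) => /=.
by rewrite exprMn !Cartier_sqr mderiv_all_sqr.
Qed.

(* Fedder's criterion: multiplying by [f * w] before applying the Cartier operator
   gives a splitting of [S] that maps [(f)] to itself. *)
Lemma Cartier_Spec_F_pure (f : S) :
  mderiv_all (f * w) = 1 -> Spec_F_pure 2 (pquot f).
Proof.
move=> fw1 t; apply: Frob_splitting_pure; apply: Frob_splitting_stalk => //.
apply: (@Frob_splitting_pquot _ _ _ (fun g => Cartier (f * w * g))) => [|p q|p q|p].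
- by apply: (sqrr_inj_pchar2 char_S); rewrite Cartier_sqr mulr1 fw1 expr1n.
- by rewrite mulrBr CartierB.
- by rewrite mulrA Cartier_sqrM.
- exists (Cartier (w * p)); rewrite -Cartier_sqrM; congr Cartier; ring.
Qed.

End CartierOperator.

(** * Chains of primes in polynomial rings *)

Section IdealLemmas.
Variables (A : comPzRingType) (I : set A).
Hypothesis I_ideal : ideal I.

Lemma idealN a : I a -> I (- a).
Proof. by case: I_ideal => _ _ IM Ia; rewrite -mulN1r; apply: IM. Qed.

Lemma idealB a b : I a -> I b -> I (a - b).
Proof. by case: I_ideal => _ ID _ Ia Ib; apply: ID => //; apply: idealN. Qed.

Lemma idealMr a b : I a -> I (a * b).
Proof. by case: I_ideal => _ _ IM Ia; rewrite mulrC; apply: IM. Qed.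

Lemma ideal_sum (T : finType) (P : pred T) (F : T -> A) :
  (forall t, P t -> I (F t)) -> I (\sum_(t | P t) F t).
Proof. by case: I_ideal => I0 ID _ PF; elim/big_ind: _. Qed.

End IdealLemmas.

Lemma prime_idealX (A : comPzRingType) (Q : set A) a n :
  prime_ideal Q -> Q (a ^+ n) -> Q a.
Proof.
case=> _ Q1 QM; elim: n => [/Q1 //|n IH].
by rewrite exprS => /QM[].
Qed.

(* The terms of the relation whose exponents agree with those of the lexicographically
   smallest term in the first [j] places survive modulo [Q j], once divided by the
   common power of the first [j] elements. *)
Lemma prime_chain_relation (A : comPzRingType) (r E : nat) (Q : nat -> set A)
    (h : 'I_r -> A) (c : {ffun 'I_r -> 'I_E} -> A) :
  (forall i, (i <= r)%N -> prime_ideal (Q i)) ->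
  (forall i : 'I_r, Q i `<=` Q i.+1) ->
  (forall i : 'I_r, Q i.+1 (h i) /\ ~ Q i (h i)) ->
  Q 0%N (\sum_e c e * \prod_i h i ^+ e i) ->
  (forall e, c e = 0 \/ ~ Q r (c e)) -> forall e, c e = 0.
Proof.
move=> Qpr QS hQ Q0 cQ e0; apply: contrapT => ce0.
(* [B] is the set of surviving exponents, which agree in the first [j] places. At [j = r] it is a
   single exponent [e], and the sum reduces to [c e], a nonzero coefficient in [Q r]. *)
suff step j : (j <= r)%N -> exists B : {set {ffun 'I_r -> 'I_E}},
    [/\ B != finset.set0, (forall e, e \in B -> c e <> 0),
      (forall e e' (i : 'I_r), e \in B -> e' \in B -> (i < j)%N -> e i = e' i) &
      Q j (\sum_(e in B) c e * \prod_(i : 'I_r | (j <= i)%N) h i ^+ e i)].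
  have [B [/set0Pn[e eB] cB eqB]] := step r (leqnn r).
  have -> : B = finset.set1 e.
    apply/setP => e'; rewrite !inE; apply/idP/eqP => [e'B|-> //].
    by apply/ffunP => i; apply: eqB.
  rewrite big_set1 big1 ?mulr1; last by move=> i; rewrite leqNgt ltn_ord.
  by case: (cQ e) => // /(cB e eB).
elim: j => [_|j IH lt_jr].
  exists [set e | c e != 0]%SET; split => [|e|e e' i|] //.
  - by apply/set0Pn; exists e0; rewrite inE; apply/eqP.
  - by rewrite inE => /eqP.
  - rewrite (_ : \sum_(e in _) _ = \sum_e c e * \prod_i h i ^+ e i) //.
    rewrite [RHS](bigID (fun e => c e == 0)) /= [X in X + _]big1 ?add0r.
      by apply: eq_bigl => e; rewrite inE.
    by move=> e /eqP ->; rewrite mul0r.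
have [B [/set0Pn[e eB] cB eqB QB]] := IH (ltnW lt_jr).
pose i := Ordinal lt_jr; have [Qh Qh'] := hQ i.
have [Qj_ideal _ QjM] := Qpr j (ltnW lt_jr).
have [Qj1_ideal _ _] := Qpr j.+1 lt_jr.
(* The least exponent [m] of [h i] over [B] gives the common factor [h i ^+ m], which can be
   cancelled modulo [Q j] because [h i] is not in [Q j]. *)
case: (@arg_minnP _ e (mem B) (fun e' => val (e' i)) eB) => e1.
rewrite -[mem B e1]/(e1 \in B) => e1B e1min.
set m := val (e1 i) in e1min.
exists [set e' in B | val (e' i) == m]%SET; split.
- by apply/set0Pn; exists e1; rewrite inE e1B eqxx.
- by move=> e'; rewrite inE => /andP[/cB].
- move=> e2 e3 l; rewrite !inE => /andP[e2B /eqP e2i] /andP[e3B /eqP e3i].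
  rewrite ltnS leq_eqVlt => /orP[/eqP lj|]; last exact: eqB.
  by have -> : l = i by [apply: val_inj]; apply: val_inj; rewrite e2i e3i.
pose P (e' : {ffun 'I_r -> 'I_E}) : A := \prod_(l : 'I_r | (j < l)%N) h l ^+ e' l.
have split_h (e' : {ffun 'I_r -> 'I_E}) : \prod_(l : 'I_r | (j <= l)%N) h l ^+ e' l
    = h i ^+ e' i * P e'.
  rewrite (bigD1 i) //=; congr (_ * _); apply: eq_bigl => l.
  by rewrite ltn_neqAle andbC eq_sym.
have : Q j (h i ^+ m * \sum_(e' in B) c e' * (h i ^+ (e' i - m) * P e')).
  rewrite mulr_sumr (eq_bigr (fun e' => c e' * \prod_(l : 'I_r | (j <= l)%N) h l ^+ e' l)) //.
  move=> e' e'B; rewrite split_h mulrCA; congr (_ * _); rewrite mulrA -exprD.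
  by rewrite subnKC //; apply: e1min.
case/QjM => [/(prime_idealX (Qpr j (ltnW lt_jr)))//|/(QS i)].
rewrite (bigID (fun e' : {ffun _ -> _} => val (e' i) == m)) /=.
set s := \sum_(_ in B | _) _; set t := \sum_(_ in B | _) _ => Qst.
(* The terms whose exponent at [i] exceeds [m] keep a factor [h i], which lies in [Q j.+1]. *)
have Qt : Q j.+1 t.
  apply: (ideal_sum Qj1_ideal) => e' /andP[e'B neq].
  case: (Qj1_ideal) => _ _ QM; apply: (QM); apply: idealMr => //.
  have : (0 < e' i - m)%N by rewrite subn_gt0 ltn_neqAle eq_sym neq e1min.
  by case: (e' i - m)%N => // q _; rewrite exprS; apply: idealMr.
have := idealB Qj1_ideal Qst Qt; rewrite addrK; congr (Q j.+1 _).
rewrite /s; apply: eq_big => [e'|e' /andP[_ /eqP ->]]; first by rewrite inE.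
by rewrite subnn expr0 mul1r.
Qed.

Section AlgebraicDependence.
Variables (k : fieldType) (n : nat).
Local Notation S := {mpoly k[n]}.

(** [(msize p).-1] is the total degree, with the value 0 at the zero polynomial; this is why only an
    inequality holds. *)
Lemma msize_predM_le (p q : S) :
  ((msize (p * q)).-1 <= (msize p).-1 + (msize q).-1)%N.
Proof.
have [->|p0] := eqVneq p 0; first by rewrite mul0r msize0.
have [->|q0] := eqVneq q 0; first by rewrite mulr0 msize0.
rewrite msizeM //; move: p0 q0; rewrite -!msize_poly_eq0.
by case: (msize p) => // a; case: (msize q) => // b _ _; rewrite addnS.
Qed.

Lemma msize_predX_le (p : S) e : ((msize (p ^+ e)).-1 <= e * (msize p).-1)%N.
Proof.
elim: e => [|e IH]; first by rewrite expr0 msize1.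
by rewrite exprS mulSn (leq_trans (msize_predM_le _ _)) // leq_add2l.
Qed.

(** A count of dimensions: there are [E ^ n.+1] products of powers of the [h i] with exponents below
    [E], while their degrees grow linearly in [E], so they lie in a space of dimension of order
    [E ^ n]. *)
Lemma mpoly_algebraic_dependence (h : 'I_n.+1 -> S) :
  exists E (c : {ffun 'I_n.+1 -> 'I_E} -> k),
    (exists e, c e <> 0) /\ \sum_e (c e)%:MP * \prod_i h i ^+ e i = 0.
Proof.
pose D := \max_i (msize (h i)).-1.
(* [B] exceeds the degree of every such product, and [B <= C * E]; hence
   [B ^ n <= C ^ n * E ^ n < E ^ n.+1]. *)
pose C := (n.+1 * D).+1; pose E := (C ^ n).+1; pose B := (n.+1 * (E * D)).+1.
have lt_BE : (B ^ n < E ^ n.+1)%N.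
  have le_exp a b : (a <= b)%N -> (a ^ n <= b ^ n)%N.
    by move=> le_ab; elim: n => // n' IH; rewrite !expnS leq_mul.
  apply: (@leq_ltn_trans ((C * E) ^ n)).
    apply: le_exp; rewrite /B /C [(E * D)%N]mulnC mulnA [leqRHS]mulSn.
    by rewrite -[leqLHS]addn1 addnC leq_add2r.
  by rewrite expnMn expnSr mulnC ltn_pmul2l ?expn_gt0.
pose T := {ffun 'I_n.+1 -> 'I_E}; pose U := {ffun 'I_n -> 'I_B}.
pose hX (e : T) := \prod_i h i ^+ e i.
pose mon (u : U) := [multinom val (u i) | i < n].
(* One row of coefficients for each product; there are more rows than columns, so a nonzero vector
   of the left kernel exists and is the relation. *)
pose M : 'M[k]_(#|{: T}|, #|{: U}|) :=
  \matrix_(i, j) (hX (enum_val i))@_(mon (enum_val j)).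
have hX_deg e m : m \in msupp (hX e) -> (mdeg m <= n.+1 * (E * D))%N.
  move=> /msize_mdeg_lt lt_m; have {lt_m} : (mdeg m <= (msize (hX e)).-1)%N.
    by rewrite -ltnS (ltn_predK lt_m).
  move/leq_trans; apply; rewrite -[n.+1 in X in (_ <= X)%N]card_ord -sum_nat_const /hX.
  elim/big_rec2: _ => [|i d p _ IH]; first by rewrite msize1.
  rewrite (leq_trans (msize_predM_le _ _)) // leq_add // (leq_trans (msize_predX_le _ _)) //.
  by rewrite leq_mul ?(ltnW (ltn_ord _)) // (leq_bigmax (F := fun i => (msize (h i)).-1)).
have /rowV0Pn[v /sub_kermxP vM v_neq0] : kermx M != 0.
  rewrite -mxrank_eq0 mxrank_ker subn_eq0 -ltnNge (leq_ltn_trans (rank_leq_col M)) //.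
  by rewrite !card_ffun !card_ord.
exists E, (fun e => v 0 (enum_rank e)); split.
  apply: contrapT => v0; case/eqP: v_neq0; apply/rowP => i; rewrite mxE.
  by apply: contrapT => vi; apply: v0; exists (enum_val i); rewrite enum_valK.
apply/mpolyP => m; rewrite mcoeff0 raddf_sum /=.
under eq_bigr do rewrite mcoeffCM.
(* Monomials of larger degree occur in no product; the remaining ones index columns of [M]. *)
have [le_mB|lt_Bm] := leqP (mdeg m) (n.+1 * (E * D)); last first.
  rewrite big1 // => e _; rewrite [X in _ * X](_ : _ = 0) ?mulr0 //.
  by apply: memN_msupp_eq0; apply: contraL lt_Bm => /hX_deg; rewrite -leqNgt.
have lt_mB i : (m i < B)%N.
  by rewrite ltnS (leq_trans _ le_mB) // mdegE (bigD1 i) //= leq_addr.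
pose u : U := [ffun i => Ordinal (lt_mB i)].
have mE : m = mon u by apply/mnmP => i; rewrite mnmE ffunE.
have /rowP/(_ (enum_rank u)) := vM; rewrite !mxE => e; rewrite -[RHS]e.
rewrite (reindex (@enum_val T T)) /=; last exact/onW_bij/enum_val_bij.
by apply: eq_bigr => i _; rewrite enum_valK mxE enum_rankK -mE.
Qed.

(** In a longer chain choose [h i] in [Q i.+1] outside [Q i]. These [n.+1] elements satisfy a
    relation with constant coefficients, and nonzero constants lie in no prime, which contradicts
    [prime_chain_relation]. *)
Lemma mpoly_prime_chain (d : nat) : prime_chain S d -> (d <= n)%N.
Proof.
case=> Q [Qpr QS]; rewrite leqNgt; apply/negP => lt_nd.
have h_ex (i : 'I_n.+1) : exists a, Q i.+1 a /\ ~ Q i a.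
  apply: contrapT => no; have [_] := QS i (leq_trans (ltn_ord i) lt_nd).
  by apply=> a Qa; apply: contrapT => Qa'; apply: no; exists a.
have [h hE] := choice h_ex.
have [E [c [[e ce] sum0]]] := mpoly_algebraic_dependence h.
suff /(_ e)/eqP : forall e, (c e)%:MP = 0 :> S by rewrite mpolyC_eq0 => /eqP.
apply: (@prime_chain_relation _ _ E Q h) => //.
- by move=> i le_in; apply: Qpr; apply: leq_trans lt_nd.
- by move=> i; case: (QS i (leq_trans (ltn_ord i) lt_nd)).
- by rewrite sum0; case: (Qpr 0%N isT) => -[].
- move=> e'; have [->|ce'] := eqVneq (c e') 0; first by left; rewrite mpolyC0.
  right=> Qc; case: (Qpr n.+1 lt_nd) => -[_ _ QM] Q1 _; apply: Q1.
  by rewrite -mpolyC1 -(mulVf ce') mpolyCM; apply: QM.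
Qed.

End AlgebraicDependence.

(** * Polynomials that are linear in the last variable *)

Section LinearPolynomial.
Variable k : fieldType.

Local Notation S := {mpoly k[4]}.
Local Notation i0 := (@Ordinal 4 0 isT).
Local Notation i1 := (@Ordinal 4 1 isT).
Local Notation i2 := (@Ordinal 4 2 isT).
Local Notation i3 := (@Ordinal 4 3 isT).
Local Notation x := ('X_i0 : S).
Local Notation y := ('X_i1 : S).
Local Notation z := ('X_i2 : S).
Local Notation w := ('X_i3 : S).

Definition subst (a b c d : S) : S -> S := comp_mpoly [tuple a; b; c; d].

HB.instance Definition _ a b c d := GRing.RMorphism.on (subst a b c d).

Lemma substC a b c d (e : k) : subst a b c d e%:MP = e%:MP.
Proof. exact: comp_mpolyC. Qed.

Lemma subst0 a b c d : subst a b c d 0 = 0.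
Proof. exact: rmorph0. Qed.

Lemma substx a b c d : subst a b c d x = a. Proof. exact: comp_mpolyXU. Qed.
Lemma substy a b c d : subst a b c d y = b. Proof. exact: comp_mpolyXU. Qed.
Lemma substz a b c d : subst a b c d z = c. Proof. exact: comp_mpolyXU. Qed.
Lemma substw a b c d : subst a b c d w = d. Proof. exact: comp_mpolyXU. Qed.

Definition substXE := (substx, substy, substz, substw).

Lemma ord4_ind (P : 'I_4 -> Prop) : P i0 -> P i1 -> P i2 -> P i3 -> forall i, P i.
Proof.
move=> P0 P1 P2 P3 i.
have : i \in [:: i0; i1; i2; i3] by case: i => [[|[|[|[|]]]]].
by rewrite !inE => /or4P[] /eqP ->.
Qed.

Lemma subst_unique (phi psi : {rmorphism S -> S}) :
  (forall e : k, phi e%:MP = psi e%:MP) -> phi x = psi x -> phi y = psi y ->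
  phi z = psi z -> phi w = psi w -> phi =1 psi.
Proof.
move=> eC ex ey ez ew; elim/mpoly_ring_ind => [//||p q IHp IHq|p q IHp IHq].
- exact: ord4_ind.
- by rewrite !rmorphD IHp IHq.
- by rewrite !rmorphM IHp IHq.
Qed.

Lemma subst_id p : subst x y z w p = p.
Proof.
have := subst_unique (phi := subst x y z w) (psi := idfun); apply=> [e||||].
all: by rewrite /= ?substC ?substXE.
Qed.

Lemma subst_subst a b c d a' b' c' d' p :
  subst a b c d (subst a' b' c' d' p) =
  subst (subst a b c d a') (subst a b c d b') (subst a b c d c') (subst a b c d d') p.
Proof.
have := subst_unique (phi := subst a b c d \o subst a' b' c' d') (psi := subst _ _ _ _).
by apply=> [e||||]; rewrite /= ?substC ?substXE.
Qed.

(** A first-order Taylor expansion. Compared with the identity substitution, it turns the vanishing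
    of a specialization into divisibility or into membership in the ideal of the origin. *)
Lemma subst_congr a b c d a' b' c' d' p : exists q0 q1 q2 q3,
  subst a b c d p - subst a' b' c' d' p =
  q0 * (a - a') + q1 * (b - b') + q2 * (c - c') + q3 * (d - d').
Proof.
elim/mpoly_ring_ind: p => [e|||].
- by exists 0, 0, 0, 0; rewrite !substC subrr; ring.
- apply: ord4_ind; rewrite !substXE; [exists 1, 0, 0, 0|exists 0, 1, 0, 0
    |exists 0, 0, 1, 0|exists 0, 0, 0, 1]; ring.
- move=> p q [p0 [p1 [p2 [p3 pE]]]] [q0 [q1 [q2 [q3 qE]]]].
  exists (p0 + q0), (p1 + q1), (p2 + q2), (p3 + q3); rewrite !rmorphD opprD addrACA pE qE.
  ring.
- move=> p q [p0 [p1 [p2 [p3 pE]]]] [q0 [q1 [q2 [q3 qE]]]]; rewrite !rmorphM /=.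
  move: (subst a b c d p) (subst a' b' c' d' p) pE => P P' pE.
  move: (subst a b c d q) (subst a' b' c' d' q) qE => Q Q' qE.
  exists (p0 * Q + P' * q0), (p1 * Q + P' * q1), (p2 * Q + P' * q2), (p3 * Q + P' * q3).
  transitivity ((P - P') * Q + P' * (Q - Q')); first by ring.
  by rewrite pE qE; ring.
Qed.

(** Independence of [w] is expressed by invariance under substitution, so that it passes to sums and
    products by the morphism laws. *)
Definition wfree (p : S) : Prop := forall q, subst x y z q p = p.

Lemma wfreeC (e : k) : wfree e%:MP. Proof. by move=> q; rewrite substC. Qed.
Lemma wfree0 : wfree 0. Proof. by move=> q; rewrite rmorph0. Qed.
Lemma wfree1 : wfree 1. Proof. by move=> q; rewrite rmorph1. Qed.
Lemma wfreex : wfree x. Proof. by move=> q; rewrite substXE. Qed.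
Lemma wfreey : wfree y. Proof. by move=> q; rewrite substXE. Qed.
Lemma wfreez : wfree z. Proof. by move=> q; rewrite substXE. Qed.

Lemma wfreeD p q : wfree p -> wfree q -> wfree (p + q).
Proof. by move=> wp wq r; rewrite rmorphD /= wp wq. Qed.

Lemma wfreeN p : wfree p -> wfree (- p).
Proof. by move=> wp r; rewrite rmorphN /= wp. Qed.

Lemma wfreeM p q : wfree p -> wfree q -> wfree (p * q).
Proof. by move=> wp wq r; rewrite rmorphM /= wp wq. Qed.

Lemma wfreeX p n : wfree p -> wfree (p ^+ n).
Proof. by move=> wp r; rewrite rmorphXn /= wp. Qed.

Variables (u g f : S).
Hypotheses (u_neq0 : u != 0) (u_wfree : wfree u) (g_wfree : wfree g).
Hypothesis fE : f = u * w + g.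

(** Replacing [w] by a high power [w ^+ B] leaves [d] and [g] unchanged but raises the degree of [f]
    above that of [d]. *)
Lemma wfree_mul_linear d h : wfree d -> d = h * f -> d = 0.
Proof.
move=> d_wfree dE; apply: contrapT => /eqP d0.
pose B := maxn (msize d) (msize g).
pose tau := subst x y z (w ^+ B).
have tauf : tau f = u * w ^+ B + g.
  by rewrite fE /tau rmorphD rmorphM /= u_wfree g_wfree substXE.
have dE' : d = tau h * tau f by rewrite -[LHS](d_wfree (w ^+ B)) dE /tau -rmorphM.
have [th0 tf0] : tau h != 0 /\ tau f != 0.
  by apply/andP; rewrite -negb_or -mulf_eq0 -dE'.
have le_tf : (msize (tau f) <= B)%N.
  rewrite leq_max dE' msizeM //; move: th0; rewrite -msize_poly_eq0.
  by case: (msize (tau h)) => // a _; rewrite addSn leq_addl.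
have : (msize (u * w ^+ B) <= B)%N.
  rewrite -(addrK g (u * _)) -tauf (leq_trans (msizeD_le _ _)) // geq_max le_tf.
  by rewrite msizeN leq_maxr.
rewrite mpolyXn msizeM //; last by rewrite -msize_poly_eq0 msizeX.
rewrite msizeX mdegMn mdeg1 mul1n addnS /=; move: u_neq0; rewrite -msize_poly_eq0.
by case: (msize u) => // a _; rewrite addSn ltnNge leq_addl.
Qed.

(** Pseudo-division by [f]: modulo [f] the product [u * w] is [- g], so a power of [u] clears
    [w]. *)
Lemma linear_w_elim a : exists n d h, wfree d /\ u ^+ n * a = d + h * f.
Proof.
elim/mpoly_ring_ind: a => [e||p q|p q].
- by exists 0%N, e%:MP, 0; split; [exact: wfreeC | ring].
- apply: ord4_ind; [exists 0%N, x, 0|exists 0%N, y, 0|exists 0%N, z, 0|exists 1%N, (- g), 1].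
  + by split; [exact: wfreex | ring].
  + by split; [exact: wfreey | ring].
  + by split; [exact: wfreez | ring].
  + by split; [exact: wfreeN | rewrite fE; ring].
- move=> [n [d [h [d_wfree dE]]]] [n' [d' [h' [d_wfree' dE']]]].
  exists (n + n')%N, (u ^+ n' * d + u ^+ n * d'), (u ^+ n' * h + u ^+ n * h'); split.
    by apply: wfreeD; apply: wfreeM => //; apply: wfreeX.
  transitivity (u ^+ n' * (u ^+ n * p) + u ^+ n * (u ^+ n' * q)); first by rewrite exprD; ring.
  by rewrite dE dE'; ring.
- move=> [n [d [h [d_wfree dE]]]] [n' [d' [h' [d_wfree' dE']]]].
  exists (n + n')%N, (d * d'), (d * h' + h * d' + h * h' * f); split; first exact: wfreeM.
  transitivity ((u ^+ n * p) * (u ^+ n' * q)); first by rewrite exprD; ring.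
  by rewrite dE dE'; ring.
Qed.

(* [u] is a power of a prime element [v] not dividing [f], so no factor of [u] can
   be lost when denominators [u ^+ n] are cleared. *)
Lemma linear_w_prime (v : S) (rho : {rmorphism S -> S}) m :
  u = v ^+ m -> v != 0 -> rho f <> 0 -> rho v = 0 ->
  (forall p, rho p = 0 -> exists q, p = q * v) ->
  forall a b, (exists h, a * b = h * f) -> (exists h, a = h * f) \/ (exists h, b = h * f).
Proof.
move=> uE v0 rhof rhov rhoP.
(* One factor [v] is removed at a time: [rho] kills [v] but not [f], so it kills [h], and [v]
   divides [h]. *)
have cancel n p h : v ^+ n * p = h * f -> exists h', p = h' * f.
  elim: n h => [|n IH] h; first by rewrite expr0 mul1r; exists h.
  rewrite exprS -mulrA => E; have : rho h * rho f = 0.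
    by rewrite -rmorphM -E rmorphM rhov mul0r.
  move/eqP; rewrite mulf_eq0 => /orP[/eqP/rhoP[q qE]|/eqP//].
  apply: (IH q); apply: (mulfI v0); rewrite E qE; ring.
move=> a b [h abE].
have [n [d [ha [d_wfree dE]]]] := linear_w_elim a.
have [n' [d' [hb [d_wfree' dE']]]] := linear_w_elim b.
have dd0 : d * d' = 0.
  apply: (wfree_mul_linear (wfreeM d_wfree d_wfree')
    (h := u ^+ (n + n') * h - d * hb - ha * d' - ha * hb * f)).
  transitivity ((d + ha * f) * (d' + hb * f) - (d * hb + ha * d' + ha * hb * f) * f).
    ring.
  rewrite -dE -dE'; transitivity (u ^+ (n + n') * (a * b) - (d * hb + ha * d' + ha * hb * f) * f).
    by rewrite exprD; ring.
  by rewrite abE; ring.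
move/eqP: dd0; rewrite mulf_eq0 => /orP[] /eqP d0; [left|right].
- by apply: (cancel (m * n)%N a ha); rewrite exprM -uE dE d0 add0r.
- by apply: (cancel (m * n')%N b hb); rewrite exprM -uE dE' d0 add0r.
Qed.

End LinearPolynomial.

(** * The local ring at the origin *)

Section FrobeniusIterates.
Variable A : comPzRingType.
Hypothesis char_A : (1 + 1 : A) = 0.
Implicit Types a b c x y z : A.

Lemma sqrrD3 a b c : (a + b + c) ^+ 2 = a ^+ 2 + b ^+ 2 + c ^+ 2.
Proof.
transitivity (a ^+ 2 + b ^+ 2 + c ^+ 2 + (1 + 1) * (a * b + a * c + b * c)); first by ring.
by rewrite char_A mul0r addr0.
Qed.

(** Square the relation for [2 ^ e] and substitute for [z ^+ 2]. With [q = 2 ^ e], the factor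
    [(x y)^(2q-2)] turns [x y z] into [(x y)^(2q-1) z], and the terms in [x^2] and [y^2] into
    multiples of [x^(2q)] and [y^(2q)]. *)
Lemma sqr_relation_iter x y z c al be :
  z ^+ 2 = c * (x * y * z) + al * x ^+ 2 + be * y ^+ 2 ->
  forall e, exists c' al' be',
    z ^+ (2 ^ e) = c' * ((x * y) ^+ (2 ^ e).-1 * z) + al' * x ^+ (2 ^ e) + be' * y ^+ (2 ^ e).
Proof.
move=> zE; elim=> [|e [c' [al' [be' IH]]]].
  by exists 1, 0, 0; rewrite expn0 /= expr0; ring.
have [q qE] : exists q, (2 ^ e = q.+1)%N by exists (2 ^ e).-1; rewrite prednK ?expn_gt0.
have -> : (2 ^ e.+1 = (q + q).+2)%N by rewrite expnS qE mul2n -addnn addSn addnS.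
rewrite qE /= in IH; rewrite /=.
exists (c' ^+ 2 * c), (c' ^+ 2 * al * y ^+ q * y ^+ q + al' ^+ 2),
  (c' ^+ 2 * be * x ^+ q * x ^+ q + be' ^+ 2).
have -> : z ^+ (q + q).+2 = (z ^+ q.+1) ^+ 2 by rewrite -exprM muln2 -addnn addSn addnS.
rewrite IH sqrrD3.
transitivity (c' ^+ 2 * (x ^+ q * y ^+ q) ^+ 2 * z ^+ 2
   + al' ^+ 2 * (x ^+ q.+1) ^+ 2 + be' ^+ 2 * (y ^+ q.+1) ^+ 2).
  by rewrite !exprMn; ring.
rewrite zE !exprS !exprMn !exprD.
move: (x ^+ q) (y ^+ q) => X Y; ring.
Qed.

End FrobeniusIterates.

Section LocalRingAtOrigin.
Variable k : fieldType.
Hypothesis char_k : 2%N \in [pchar k].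

Local Notation S := {mpoly k[4]}.
Local Notation i0 := (@Ordinal 4 0 isT).
Local Notation i1 := (@Ordinal 4 1 isT).
Local Notation i2 := (@Ordinal 4 2 isT).
Local Notation i3 := (@Ordinal 4 3 isT).
Local Notation x := ('X_i0 : S).
Local Notation y := ('X_i1 : S).
Local Notation z := ('X_i2 : S).
Local Notation w := ('X_i3 : S).
Local Notation ev0 := (@subst k 0 0 0 0).

(** [A] stands for the local ring of [S / (f)] at the origin, described through the map [iota] by
    its fractions, units and kernel, so that quotients of quotients need not be unfolded. *)
Variables (f c al be : S) (A : comPzRingType) (iota : S -> A).
Hypothesis fE : f = z ^+ 2 + c * (x * y * z) + al * x ^+ 2 + be * y ^+ 2.
Hypothesis iota1 : iota 1 = 1.
Hypothesis iotaD : {morph iota : a b / a + b}.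
Hypothesis iotaM : {morph iota : a b / a * b}.
Hypothesis iota_frac : forall t, exists a s, ev0 s <> 0 /\ iota s * t = iota a.
Hypothesis iota_unit : forall s, ev0 s <> 0 -> exists t, t * iota s = 1.
Hypothesis iota_eq0 : forall a,
  iota a = 0 <-> exists r h, ev0 r <> 0 /\ r * a = h * f.

Let iota0 : iota 0 = 0.
Proof. by have := iotaD 0 0; rewrite addr0 -[LHS]addr0 => /addrI. Qed.

Let iotaN a : iota (- a) = - iota a.
Proof. by apply/eqP; rewrite -subr_eq0 opprK -iotaD addNr iota0. Qed.

Let iotaB a b : iota (a - b) = iota a - iota b.
Proof. by rewrite iotaD iotaN. Qed.

Let iotaX a n : iota (a ^+ n) = iota a ^+ n.
Proof. by elim: n => [|n IH]; rewrite ?expr0 // !exprS iotaM IH. Qed.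

Let iota_f : iota f = 0.
Proof. by apply/iota_eq0; exists 1, 1; rewrite rmorph1; split => //; apply/eqP/oner_neq0. Qed.

Let char_A : (1 + 1 : A) = 0.
Proof.
rewrite -iota1 -iotaD (_ : 1 + 1 = 0) ?iota0 //.
exact: (addrr_pchar2 (mpoly_pchar2 4 char_k)).
Qed.

Let ev0M a b : ev0 a <> 0 -> ev0 b <> 0 -> ev0 (a * b) <> 0.
Proof. by move=> /eqP a0 /eqP b0; apply/eqP; rewrite rmorphM mulf_neq0. Qed.

Let iota_z2 : iota z ^+ 2 =
  iota c * (iota x * iota y * iota z) + iota al * iota x ^+ 2 + iota be * iota y ^+ 2.
Proof.
have := iota_f; rewrite fE !iotaD !iotaM -!expr2 -!addrA => /eqP.
rewrite addr_eq0 => /eqP ->; rewrite -[LHS]mulN1r.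
have -> : (-1 : A) = 1 by apply/eqP; rewrite eq_sym -subr_eq0 opprK char_A.
by rewrite mul1r.
Qed.

Definition params : seq A := [:: iota x; iota y; iota w].
Local Notation I := (ideal_gen [set` params]).

Lemma params_ideal : I (iota x) /\ I (iota y) /\ I (iota w).
Proof. by do !split; apply: sub_ideal_gen; rewrite /= !inE eqxx ?orbT. Qed.

(* Setting [x = y = w = 0] turns [f] into [z ^+ 2]. *)
Lemma iota_z_notin : ~ I (iota z).
Proof.
pose si := @subst k 0 0 z 0.
(* The kernel of the map from [A] to the local ring of [k[z] / (z^2)] at 0, stated with
   fractions. *)
pose J : set A := [set t | exists a s, [/\ ev0 s <> 0, iota s * t = iota a &
  exists h, si a = h * z ^+ 2]].
have ev01 : ev0 1 <> 0 by rewrite rmorph1; apply/eqP/oner_neq0.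
have Jgen a : si a = 0 -> J (iota a).
  move=> a0; exists a, 1; split=> //; first by rewrite iota1 mul1r.
  by exists 0; rewrite mul0r.
have J_ideal : ideal J.
  split.
  - by rewrite -iota0; apply: Jgen; rewrite /si rmorph0.
  - move=> t t' [a [s [s0 sE [h hE]]]] [a' [s' [s0' sE' [h' hE']]]].
    exists (s' * a + s * a'), (s * s'); split; first exact: ev0M.
      by rewrite iotaD !iotaM -sE -sE'; ring.
    by exists (si s' * h + si s * h'); rewrite /si rmorphD !rmorphM /= -/si hE hE'; ring.
  - move=> t t' [a [s [s0 sE [h hE]]]]; have [b [r [r0 rE]]] := iota_frac t.
    exists (b * a), (r * s); split; first exact: ev0M.
      by rewrite !iotaM -sE -rE; ring.
    by exists (si b * h); rewrite /si rmorphM /= -/si hE; ring.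
move=> /(ideal_gen_sub J_ideal)[t|a [s [s0 sE [h hE]]]].
  by rewrite /= !inE => /or3P[] /eqP ->; apply: Jgen; rewrite /si substXE.
(* If [z] were in [J], then [si (r * s) * z] would be a multiple of [z ^+ 2], so [r * s] would
   vanish at the origin. *)
have /iota_eq0[r [g [r0 rE]]] : iota (s * z - a) = 0 by rewrite iotaB iotaM sE subrr.
have : si r * si s * z - si r * (h * z ^+ 2) = si g * z ^+ 2.
  have sf : si f = z ^+ 2.
    by rewrite fE /si !rmorphD !rmorphM /= !substXE; ring.
  rewrite -[in RHS]sf -hE -[RHS](rmorphM si) -rE /si !(rmorphM, rmorphB) /= substXE; ring.
move=> E; have {}E : (si r * si s) * z = ((si g + si r * h) * z) * z.
  by rewrite -[LHS](subrK (si r * (h * z ^+ 2))) E; ring.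
have z0 : z != 0 by rewrite -msize_poly_eq0 msizeX.
apply: (ev0M r0 s0).
have ev0si p : ev0 (si p) = ev0 p.
  by rewrite /si subst_subst !subst0 substXE.
rewrite -ev0si; have -> : si (r * s) = (si g + si r * h) * z.
  by apply: (mulIf z0); rewrite -[RHS]E; congr (_ * _); apply: rmorphM.
by rewrite rmorphM /= substXE mulr0.
Qed.

Lemma not_F_pure_origin : c = 0 -> ~ F_pure 2 A.
Proof.
move=> c0 pureA; have [Ix [Iy _]] := params_ideal.
apply: iota_z_notin; apply: (F_pure_frobenius_power pureA); first exact: ideal_gen_ideal.
have [_ FD FM] := ideal_gen_ideal [set a ^+ 2 | a in I].
rewrite iota_z2 c0 iota0 mul0r add0r.
by apply: FD; apply: FM; apply: sub_ideal_gen; [exists (iota x) | exists (iota y)].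
Qed.

Lemma iota_ev0P a : (~ exists t, t * iota a = 1) <-> ev0 a = 0.
Proof.
split=> [nu|a0 [t tE]]; first by apply: contrapT => /iota_unit.
have [b [s [s0 sE]]] := iota_frac t.
have /iota_eq0[r [h [r0]]] : iota (b * a - s) = 0.
  by rewrite iotaB iotaM -sE -mulrA tE mulr1 subrr.
move/(congr1 ev0); rewrite !rmorphM rmorphB rmorphM /= a0 mulr0 sub0r.
have -> : ev0 f = 0 by rewrite fE !rmorphD !rmorphM /= !substXE; ring.
by rewrite mulr0 mulrN => /eqP; rewrite oppr_eq0 mulf_eq0 => /orP[] /eqP.
Qed.

(** Such an [a] is a combination of the variables; squaring is additive, and [z ^+ 2] lies in [I] by
    the equation. Thus [I] contains the square of every nonunit. *)
Lemma iota_sqr_params a : ev0 a = 0 -> I (iota a ^+ 2).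
Proof.
move=> a0; have [q0 [q1 [q2 [q3]]]] := subst_congr x y z w 0 0 0 0 a.
rewrite subst_id a0 !subr0 => ->; rewrite !iotaD !iotaM.
have [Ix [Iy Iw]] := params_ideal; have [I0 ID IM] := ideal_gen_ideal [set` params].
have -> t0 t1 t2 t3 : (t0 + t1 + t2 + t3 : A) ^+ 2
    = t0 ^+ 2 + t1 ^+ 2 + t2 ^+ 2 + t3 ^+ 2.
  rewrite -[t0 + t1 + t2 + t3]addr0 sqrrD3 // -addrA (sqrrD3 char_A) addrA.
  by rewrite expr0n addr0.
rewrite 4!exprMn iota_z2.
have Isq t u : I u -> I (t * u ^+ 2) by move=> Iu; apply: (IM); rewrite expr2; apply: IM.
apply: (ID); last exact: Isq.
apply: (ID); last first.
  apply: (IM); apply: (ID); last exact: Isq.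
  by apply: (ID); [rewrite [_ * iota z]mulrC; do 3!apply: (IM) | exact: Isq].
by apply: ID; exact: Isq.
Qed.

Hypothesis f_prime : forall a b,
  (exists h, a * b = h * f) -> (exists h, a = h * f) \/ (exists h, b = h * f).
Hypothesis x_notin : ~ exists h, x = h * f.
Hypothesis y_notin : ~ exists h, y = h * f.

Let ev0f : ev0 f = 0.
Proof. by rewrite fE !rmorphD !rmorphM /= !substXE; ring. Qed.

(** A denominator does not vanish at the origin, hence is no multiple of [f], and primality of [(f)]
    cancels it. *)
Lemma iota_eq0P a : iota a = 0 <-> exists h, a = h * f.
Proof.
split=> [/iota_eq0[r [h [r0 rE]]]|[h ->]]; last by rewrite iotaM iota_f mulr0.
have [||//] := @f_prime r a; first by exists h.
by move=> [g gE]; case: r0; rewrite gE rmorphM /= ev0f mulr0.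
Qed.

Lemma zero_prime_ideal : prime_ideal [set (0 : A)].
Proof.
split.
- split=> [|t t' -> ->|t t' ->]; rewrite /= ?addr0 ?mulr0 //.
- rewrite /= -iota1 => /iota_eq0[r [h [r0]]]; rewrite mulr1 => rE.
  by apply: r0; rewrite rE rmorphM /= ev0f mulr0.
move=> t t' /= tt0.
have cancel s u v : ev0 s <> 0 -> iota s * u = iota v -> (exists h, v = h * f) -> u = 0.
  move=> /iota_unit[b bE] sE /iota_eq0P v0.
  by rewrite -[u]mul1r -bE -mulrA sE v0 mulr0.
have [a [s [s0 sE]]] := iota_frac t; have [a' [s' [s0' sE']]] := iota_frac t'.
have /iota_eq0P/f_prime[] : iota (a * a') = 0.
  by rewrite iotaM -sE -sE' mulrACA tt0 mulr0.
- by move/(cancel _ _ _ s0 sE); left.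
- by move/(cancel _ _ _ s0' sE'); right.
Qed.

Lemma iota_z_tight_closure : tight_closure 2 I (iota z).
Proof.
(* In a domain the only minimal prime is 0, so a multiplier has to be nonzero. The choice [x] turns
   the term in [(x y)^(q-1)] into a multiple of [x^q]. *)
exists (iota x); split=> [Q [Q_prime Qmin] Qx|].
  have [[Q0 _ _] _ _] := Q_prime.
  have Q_0 : [set 0] = Q by apply: Qmin; [exact: zero_prime_ideal | move=> t /= ->; exact: Q0].
  by move: Qx; rewrite -Q_0 => /iota_eq0P.
exists 0%N => e _; have [Ix [Iy _]] := params_ideal.
have [c' [al' [be' ->]]] := sqr_relation_iter char_A iota_z2 e.
have [_ FD FM] := ideal_gen_ideal [set a ^+ (2 ^ e) | a in I].
have Fx t : frobenius_power I (2 ^ e) (t * iota x ^+ (2 ^ e)).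
  by apply: FM; apply: sub_ideal_gen; exists (iota x).
have Fy t : frobenius_power I (2 ^ e) (t * iota y ^+ (2 ^ e)).
  by apply: FM; apply: sub_ideal_gen; exists (iota y).
rewrite 2!mulrDr; apply: (FD); first apply: (FD); last by rewrite mulrA; apply: Fy.
  have [q qE] : exists q, (2 ^ e = q.+1)%N.
    by exists (2 ^ e).-1; rewrite prednK ?expn_gt0.
  have -> : iota x * (c' * ((iota x * iota y) ^+ (2 ^ e).-1 * iota z))
      = c' * iota y ^+ q * iota z * iota x ^+ (2 ^ e) by rewrite qE /= exprMn exprS; ring.
  exact: Fx.
by rewrite mulrA; apply: Fx.
Qed.

Section KernelIdeal.
Variable psi : {rmorphism S -> S}.
Hypothesis psif : psi f = 0.
Hypothesis psi_ev0 : forall a, psi a = 0 -> ev0 a = 0.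

(** The extension to [A] of the kernel of [psi]. Kernels of endomorphisms of the domain [S] are
    prime, so a parametrization of a subvariety through the origin yields a prime of [A]. *)
Definition ker_ideal : set A :=
  [set t | exists a s, [/\ ev0 s <> 0, iota s * t = iota a & psi a = 0]].

Lemma ker_ideal_iota a : ker_ideal (iota a) <-> psi a = 0.
Proof.
split=> [[b [s [s0 sE b0]]]|a0]; last first.
  by exists a, 1; rewrite rmorph1 iota1 mul1r; split => //; apply/eqP/oner_neq0.
have /iota_eq0P[h hE] : iota (s * a - b) = 0 by rewrite iotaB iotaM sE subrr.
have := congr1 psi hE; rewrite rmorphB !rmorphM b0 psif mulr0 subr0 => /eqP.
by rewrite mulf_eq0 => /orP[] /eqP // /psi_ev0.
Qed.

Lemma ker_ideal_prime : prime_ideal ker_ideal.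
Proof.
(* Membership may be tested on one fixed presentation of [t] as a fraction. *)
have ker_frac t : exists a s, [/\ ev0 s <> 0, iota s * t = iota a & ker_ideal t <-> psi a = 0].
  have [a [s [s0 sE]]] := iota_frac t; exists a, s; split=> //.
  split=> [[b [r [r0 rE b0]]]|a0]; last by exists a, s.
  have /ker_ideal_iota : ker_ideal (iota (r * a)).
    exists (s * b), 1; rewrite rmorph1 iota1 mul1r rmorphM b0 mulr0.
    split=> //; first exact/eqP/oner_neq0.
    by rewrite !iotaM -sE -rE; ring.
  by rewrite rmorphM => /eqP; rewrite mulf_eq0 => /orP[] /eqP // /psi_ev0.
split.
- split=> [|t t' [a [s [s0 sE a0]]] [a' [s' [s0' sE' a0']]]|t t' [a [s [s0 sE a0]]]].
  + by rewrite -iota0 ker_ideal_iota rmorph0.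
  + exists (s' * a + s * a'), (s * s'); split; first exact: ev0M.
      by rewrite iotaD !iotaM -sE -sE'; ring.
    by rewrite rmorphD !rmorphM a0 a0' !mulr0 addr0.
  + have [b [r [r0 rE]]] := iota_frac t.
    exists (b * a), (r * s); split; first exact: ev0M.
      by rewrite !iotaM -sE -rE; ring.
    by rewrite rmorphM a0 mulr0.
- by rewrite -iota1 ker_ideal_iota rmorph1; apply/eqP/oner_neq0.
move=> t t'; have [a [s [s0 sE aE]]] := ker_frac t; have [a' [s' [s0' sE' aE']]] := ker_frac t'.
move=> [b [r [r0 rE b0]]].
have /ker_ideal_iota : ker_ideal (iota (r * (a * a'))).
  exists (s * s' * b), 1; rewrite rmorph1 iota1 mul1r rmorphM b0 mulr0.
  split=> //; first exact/eqP/oner_neq0.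
  by rewrite !iotaM -sE -sE' -rE; ring.
rewrite !rmorphM => /eqP; rewrite !mulf_eq0 => /or3P[] /eqP.
- by move/psi_ev0.
- by move/aE; left.
- by move/aE'; right.
Qed.

End KernelIdeal.

Lemma ker_ideal_sub (psi psi' : {rmorphism S -> S}) :
  (forall a, psi a = 0 -> psi' a = 0) -> ker_ideal psi `<=` ker_ideal psi'.
Proof. by move=> sub t [a [s [s0 sE a0]]]; exists a, s; split=> //; apply: sub. Qed.

(* Contracting a chain of five primes to [S] and adding the zero ideal would give a
   chain of six primes in four variables. *)
Lemma krull_dim_origin (psi1 psi2 : {rmorphism S -> S}) :
  psi1 f = 0 -> psi1 y = 0 -> psi1 x <> 0 ->
  (forall a, psi1 a = 0 -> psi2 a = 0) -> psi2 x = 0 -> psi2 w <> 0 ->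
  (forall a, psi2 a = 0 -> ev0 a = 0) -> krull_dim A 3.
Proof.
move=> psi1f psi1y psi1x psi12 psi2x psi2w psi2_ev0; split.
  (* The inclusions are strict because of [y], [x] and [w], in this order. *)
  pose Q i := match i with
    | 0 => [set 0] | 1 => ker_ideal psi1 | 2 => ker_ideal psi2 | _ => ker_ideal ev0 end.
  have psi1_ev0 a : psi1 a = 0 -> ev0 a = 0 by move/psi12/psi2_ev0.
  have pr1 := ker_ideal_prime psi1f psi1_ev0.
  have pr2 := ker_ideal_prime (psi12 _ psi1f) psi2_ev0.
  have k1 := ker_ideal_iota psi1f psi1_ev0.
  have k2 := ker_ideal_iota (psi12 _ psi1f) psi2_ev0.
  exists Q; split=> [[|[|[|i]]] _|[|[|[|//]]] _] /=.
  - exact: zero_prime_ideal.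
  - exact: pr1.
  - exact: pr2.
  - exact: ker_ideal_prime.
  - split=> [_ ->|]; first by case: pr1 => -[].
    by move/(_ (iota y) (proj2 (k1 y) psi1y)) => /iota_eq0P.
  - split; first exact: ker_ideal_sub.
    by move/(_ (iota x) (proj2 (k2 x) psi2x)) => /k1.
  - split; first exact: ker_ideal_sub.
    have w_ev0 : ker_ideal ev0 (iota w) by apply/ker_ideal_iota; rewrite //= substXE.
    by move/(_ _ w_ev0) => /k2.
case=> Q [Qpr QS].
pose P i := if i is j.+1 then [set a | Q j (iota a)] else [set (0 : S)].
suff /mpoly_prime_chain : prime_chain S 5 by [].
exists P; split=> [[|i] le_i|[|i] lt_i] /=.
- split=> [|/eqP|a b /eqP]; last 2 first.
  + by rewrite oner_eq0.
  + by rewrite mulf_eq0 => /orP[] /eqP; [left|right].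
  by split=> [|a b -> ->|a b ->]; rewrite /= ?addr0 ?mulr0.
- have [[Q0 QD QM] Q1 Qprime] := Qpr i le_i; split=> /=.
  + split=> [|a b Qa Qb|a b Qb] /=; first by rewrite iota0.
    * by rewrite iotaD; apply: QD.
    * by rewrite iotaM; apply: QM.
  + by rewrite iota1.
  + by move=> a b; rewrite iotaM; apply: Qprime.
(* The contraction of [Q 0] contains [f], which is nonzero because it becomes [z ^+ 2] at
   [x = y = 0]. *)
- have [[Q0 _ _] _ _] := Qpr 0%N isT; split=> [_ ->|]; first by rewrite /= iota0.
  move/(_ f); rewrite /= iota_f => /(_ Q0) /= f0.
  have z0 : z != 0 by rewrite -msize_poly_eq0 msizeX.
  have /eqP := congr1 (subst 0 0 z w) f0; rewrite fE !rmorphD !rmorphM /= !substXE rmorph0.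
  by rewrite !(mulr0, mul0r, addr0) mulf_eq0 orbb (negPf z0).
have [QQ QQ'] := QS i lt_i; have [[_ _ QM] _ Qprime] := Qpr i (ltnW lt_i).
have [[_ _ QM'] _ _] := Qpr i.+1 lt_i.
split=> [a /=|QQi]; first exact: QQ.
(* Contraction to [S] keeps inclusions strict, as each [t] is a unit times some [iota a]. *)
apply: QQ' => t Qt; have [a [s [s0 sE]]] := iota_frac t.
have [b bE] := iota_unit s0.
have -> : t = b * iota a by rewrite -sE mulrA bE mul1r.
by apply: QM; apply: QQi; rewrite /= -sE; apply: QM'.
Qed.

Lemma not_F_rational_origin : krull_dim A 3 -> ~ F_rational 2 A.
Proof.
move=> dimA ratA; apply: iota_z_notin.
suff <- : tight_closure 2 I = I by exact: iota_z_tight_closure.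
apply: ratA; exists [::]; rewrite cats0; split=> // t.
have [a [s [s0 sE]]] := iota_frac t; have [b bE] := iota_unit s0.
have tE : t = b * iota a by rewrite -sE mulrA bE mul1r.
have [_ ID IM] := ideal_gen_ideal [set` params].
split=> [nu|[n In] [t' t'E]].
  exists 2; rewrite tE exprMn; apply: IM; apply: iota_sqr_params.
  by apply/iota_ev0P => -[u uE]; apply: nu; exists (u * iota s); rewrite -mulrA sE.
have I1 : I 1 by rewrite -(expr1n _ n) -t'E exprMn; apply: IM.
by apply: iota_z_notin; rewrite -[iota z]mulr1; apply: IM.
Qed.

End LocalRingAtOrigin.

(** * The stalk at the origin as a ring of fractions of [S / (f)] *)

Lemma pi_pquot0 (A : comPzRingType) (f : A) : \pi_(pquot f) 0 = 0.
Proof. by have := pi_pquot_add f 0 0; rewrite addr0 -[LHS]addr0 => /addrI. Qed.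

Lemma pi_pquot1 (A : comPzRingType) (f : A) : \pi_(pquot f) 1 = 1.
Proof. by []. Qed.

Section OriginPoint.
Variable k : fieldType.

Local Notation S := {mpoly k[4]}.
Local Notation ev0 := (@subst k 0 0 0 0).

Variable f : S.
Hypothesis ev0f : ev0 f = 0.
Local Notation R := (pquot f).

Definition origin_pt : set R := [set r | exists a, r = \pi_R a /\ ev0 a = 0].

Lemma origin_ptE a : origin_pt (\pi_R a) <-> ev0 a = 0.
Proof.
split=> [[b [/eqP/pquot_eqP[h ab] b0]]|a0]; last by exists a.
have /eqP := congr1 ev0 ab; rewrite rmorphB rmorphM /= ev0f mulr0 b0 subr0.
by move/eqP.
Qed.

Lemma origin_pt_prime : prime_ideal origin_pt.
Proof.
split.
- split=> [|r r' [a [-> a0]] [b [-> b0]]|r r' [b [-> b0]]].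
  + by exists 0; rewrite -(pi_pquot0 f) rmorph0.
  + by exists (a + b); rewrite pi_pquot_add rmorphD /= a0 b0 addr0.
  + elim/quotW: r => a; exists (a * b).
    by rewrite -pi_pquot_mul rmorphM /= b0 mulr0.
- by move/origin_ptE/eqP; rewrite rmorph1 oner_eq0.
elim/quotW=> a; elim/quotW=> b; rewrite [_ * _]pi_pquot_mul => /origin_ptE/eqP.
by rewrite rmorphM mulf_eq0 => /orP[] /eqP/origin_ptE; [left | right].
Qed.

Definition origin : Spec R := Point origin_pt_prime.
(** The concrete [iota]; the lemmas that follow establish the properties assumed of it. *)
Definition to_origin (a : S) : stalk origin := \pi_(stalk origin) (\pi_R a, den1 origin).

Lemma notin_originP a : (\pi_R a \notin pt origin) <-> ev0 a <> 0.
Proof.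
split=> [/negP na a0|a0]; first by apply: na; rewrite inE; apply/origin_ptE.
by apply/negP; rewrite inE => /origin_ptE.
Qed.

Lemma to_origin1 : to_origin 1 = 1.
Proof. by apply: (@stalk_eq _ origin _ (frac1 origin)); rewrite /= pi_pquot1. Qed.

Lemma to_originD : {morph to_origin : a b / a + b}.
Proof.
move=> a b; rewrite [RHS]pi_stalk_add; apply: stalk_eq.
by rewrite /= !mulr1 pi_pquot_add.
Qed.

Lemma to_originM : {morph to_origin : a b / a * b}.
Proof.
move=> a b; rewrite [RHS]pi_stalk_mul; apply: stalk_eq.
by rewrite /= !mulr1 [RHS]pi_pquot_mul.
Qed.

Lemma to_origin_frac t : exists a s, ev0 s <> 0 /\ to_origin s * t = to_origin a.
Proof.
elim/quotW: t => -[r [s s_notin]]; elim/quotW: r => a.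
elim/quotW: s s_notin => s s_notin; exists a, s; split; first exact/notin_originP.
rewrite [LHS]pi_stalk_mul; apply: stalk_eq; rewrite /=; ring.
Qed.

Lemma to_origin_unit s : ev0 s <> 0 -> exists t, t * to_origin s = 1.
Proof.
move/notin_originP => s_notin.
exists (\pi_(stalk origin) (1, exist _ (\pi_R s) s_notin)).
by rewrite [LHS]pi_stalk_mul; apply: stalk_eq; rewrite /=; ring.
Qed.

Lemma to_origin_eq0 a :
  to_origin a = 0 <-> exists r h, ev0 r <> 0 /\ r * a = h * f.
Proof.
split=> [/eqP/stalk_eqP[r]|[r [h [r0 rE]]]].
  elim/quotW: r => r /notin_originP r0.
  rewrite /= mul0r subr0 mulr1 [_ * _]pi_pquot_mul -(pi_pquot0 f).
  by move=> /eqP/pquot_eqP[h]; rewrite subr0 => rE; exists r, h.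
apply/eqP/stalk_eqP; exists (\pi_R r); first exact/notin_originP.
rewrite /= mul0r subr0 mulr1 [_ * _]pi_pquot_mul rE -(pi_pquot0 f).
by apply/eqP/pquot_eqP; exists h; rewrite subr0.
Qed.

End OriginPoint.

Definition pure_label (L : label) : Prop :=
  L = EF 7 3 \/ L = DB 4 1 1 \/ L = DB 4 1 2 \/ L = DC 5 1 3 \/
  exists2 n : nat, (3 <= n)%N &
    (L = DB (2 * n) (n - 1) (n - 1) \/
     L = DB (2 * n) (n - 1) n \/
     L = DC (2 * n) (n - 1) (2 * n - 2) \/
     L = DB (2 * n + 1) (n - 1) (n - 1) \/
     L = DC (2 * n + 1) (n - 1) (2 * n - 1)).

Ltac not_pure_label :=
  split=> //; case=> [|[|[|[|[? ? [|[|[|[|]]]]]]]]] // []; lia.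

Ltac family_side :=
  let ring_id := (rewrite /= ?exprS; ring) in
  let wf := (do ![exact: wfreex | exact: wfreey | exact: wfreez | exact: wfree0
                 | apply: wfreeX | apply: wfreeM | apply: wfreeD]) in
  first [ring_id | by wf].

(** * The listed equations *)

Section Classification.
Variable k : closedFieldType.
Hypothesis char_k : 2%N \in [pchar k].

Local Notation S := {mpoly k[4]}.
Local Notation i0 := (@Ordinal 4 0 isT).
Local Notation i1 := (@Ordinal 4 1 isT).
Local Notation i2 := (@Ordinal 4 2 isT).
Local Notation i3 := (@Ordinal 4 3 isT).
Local Notation x := ('X_i0 : S).
Local Notation y := ('X_i1 : S).
Local Notation z := ('X_i2 : S).
Local Notation w := ('X_i3 : S).
Local Notation ev0 := (@subst k 0 0 0 0).

Let XU_neq0 i : ('X_i : S) != 0.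
Proof. by rewrite -msize_poly_eq0 msizeX. Qed.

(* The chain of primes of length 3 is 0, the kernel of (x, y, z, w) |-> (p0, 0, p2, p3),
   the kernel of this map followed by x |-> 0, and the maximal ideal. *)
Lemma not_F_rational_linear_w (f c al be v g p0 p2 p3 : S) m :
  f = z ^+ 2 + c * (x * y * z) + al * x ^+ 2 + be * y ^+ 2 ->
  v = x \/ v = y -> wfree g -> f = v ^+ m * w + g ->
  subst p0 0 p2 p3 f = 0 -> p0 != 0 -> subst 0 y z w p0 = 0 -> subst 0 y z w p3 != 0 ->
  ev0 p2 = 0 -> ev0 p3 = 0 ->
  ~ Spec_F_rational 2 (pquot f) /\ (c = 0 -> ~ Spec_F_pure 2 (pquot f)).
Proof.
move=> fE vE g_wfree flin psi1f p0_neq0 p0x p3x p20 p30.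
have ev0f : ev0 f = 0 by rewrite fE !rmorphD !rmorphM /= !substXE; ring.
have v_neq0 : v != 0 by case: vE => ->.
have v_wfree : wfree v by case: vE => ->; [exact: wfreex | exact: wfreey].
have u_neq0 : v ^+ m != 0 by rewrite expf_neq0.
have notin (p : S) : p != 0 -> wfree p -> ~ exists h, p = h * f.
  move=> p_neq0 p_wfree [h pE]; case/eqP: p_neq0.
  exact: wfree_mul_linear u_neq0 (wfreeX m v_wfree) g_wfree flin _ _ p_wfree pE.
have f_xy : subst 0 0 z w f = z ^+ 2.
  by rewrite fE !rmorphD !rmorphM /= !substXE; ring.
(* Setting [x = y = 0] afterwards yields [z ^+ 2]. In particular neither [x] nor [y] divides [f]. *)
have f_xy' (a b : S) : subst 0 0 z w a = 0 -> subst 0 0 z w b = 0 -> subst a b z w f <> 0.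
  move=> a0 b0 /(congr1 (subst 0 0 z w)); rewrite subst_subst a0 b0 !substXE f_xy subst0.
  by apply/eqP; rewrite expf_neq0.
have f_prime a b : (exists h, a * b = h * f) ->
    (exists h, a = h * f) \/ (exists h, b = h * f).
  move: a b; case: vE => vE.
  - apply: (linear_w_prime (u_neq0) (wfreeX m v_wfree) g_wfree flin (v := x)
      (rho := subst 0 y z w) (m := m)); rewrite /= ?vE ?substXE //.
      exact: (f_xy' 0 y (subst0 _ _ _ _) (substy _ _ _ _)).
    move=> p px; have [q [q1 [q2 [q3]]]] := subst_congr x y z w 0 y z w p.
    rewrite subst_id [X in _ - X]px !subr0 !subrr !mulr0 !addr0 => ->; by exists q.
  - apply: (linear_w_prime (u_neq0) (wfreeX m v_wfree) g_wfree flin (v := y)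
      (rho := subst x 0 z w) (m := m)); rewrite /= ?vE ?substXE //.
      exact: (f_xy' x 0 (substx _ _ _ _) (subst0 _ _ _ _)).
    move=> p py; have [q0 [q [q2 [q3]]]] := subst_congr x y z w x 0 z w p.
    rewrite subst_id [X in _ - X]py !subr0 !subrr !mulr0 !addr0 add0r => ->; by exists q.
have notpure := not_F_pure_origin char_k fE (@to_origin1 _ _ ev0f) (@to_originD _ _ ev0f)
  (@to_originM _ _ ev0f) (@to_origin_frac _ _ ev0f) (@to_origin_eq0 _ _ ev0f).
split; last by move=> /notpure np /(_ (origin ev0f)).
move=> /(_ (origin ev0f)).
have ev0p0 : ev0 p0 = 0.
  have := congr1 ev0 p0x; rewrite subst_subst !substXE !subst0.
  by [].
apply: (not_F_rational_origin char_k fE (@to_origin1 _ _ ev0f) (@to_originD _ _ ev0f)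
  (@to_originM _ _ ev0f) (@to_origin_frac _ _ ev0f) (@to_origin_unit _ _ ev0f)
  (@to_origin_eq0 _ _ ev0f) f_prime).
- exact: notin _ (XU_neq0 i0) (@wfreex k).
apply: (krull_dim_origin fE (@to_origin1 _ _ ev0f) (@to_originD _ _ ev0f)
  (@to_originM _ _ ev0f) (@to_origin_frac _ _ ev0f) (@to_origin_unit _ _ ev0f)
  (@to_origin_eq0 _ _ ev0f) f_prime
  _ (psi1 := subst p0 0 p2 p3) (psi2 := subst 0 y z w \o subst p0 0 p2 p3)).
- exact: notin _ (XU_neq0 i1) (@wfreey k).
- exact: psi1f.
- exact: substy.
- by rewrite /= substx; apply/eqP.
- by move=> a /= ->; rewrite subst0.
- exact: etrans (congr1 _ (substx p0 0 p2 p3)) p0x.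
- by rewrite /= (substw p0); apply/eqP.
move=> a /(congr1 ev0); rewrite /= !subst_subst !substXE !subst0 ev0p0 p20 p30.
by [].
Qed.

(** * Mixed derivatives and the three families D-B, D-C and E-F *)

Lemma mderivX0 i (p : S) n : p^`M(i) = 0 -> (p ^+ n)^`M(i) = 0.
Proof.
move=> p0; elim: n => [|n IH]; first by rewrite expr0 -mpolyC1 mderivC.
by rewrite exprS mderivM p0 IH mulr0 mul0r addr0.
Qed.

Lemma mderivM0 i (p q : S) : p^`M(i) = 0 -> q^`M(i) = 0 -> (p * q)^`M(i) = 0.
Proof. by move=> p0 q0; rewrite mderivM p0 q0 mulr0 mul0r addr0. Qed.

Lemma mderiv_all_eq0 (p : S) : p^`M(i0) = 0 \/ p^`M(i2) = 0 -> mderiv_all p = 0.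
Proof.
rewrite /mderiv_all; case=> p0.
  by rewrite p0 !mderiv0.
by rewrite (mderiv_comm i1 i2) (mderiv_comm i0 i2) p0 !mderiv0.
Qed.

Lemma mderiv_all_xyzw : mderiv_all (x * y * z * w) = 1.
Proof.
rewrite /mderiv_all.
by rewrite !(mderivM, mderiv4E, mderiv0, mulr0, mul0r, mulr1, mul1r, addr0, add0r).
Qed.

Lemma mderiv_all_family (f al be : S) :
  f = z ^+ 2 + 1 * (x * y * z) + al * x ^+ 2 + be * y ^+ 2 ->
  mderiv_all (al * w) = 0 -> mderiv_all (be * w) = 0 -> mderiv_all (f * w) = 1.
Proof.
move=> -> al0 be0.
have -> : (z ^+ 2 + 1 * (x * y * z) + al * x ^+ 2 + be * y ^+ 2) * w =
  w * z ^+ 2 + x * y * z * w + al * w * x ^+ 2 + be * w * y ^+ 2 by ring.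
rewrite !mderiv_allD !mderiv_all_sqr // al0 be0 mderiv_all_xyzw.
rewrite (mderiv_all_eq0 (p := w)) ?mderiv4E; last by left.
by rewrite !mul0r !addr0 add0r.
Qed.

Definition classified (L : label) (f : S) : Prop :=
  (Spec_F_pure 2 (pquot f) <-> pure_label L) /\ ~ Spec_F_rational 2 (pquot f).

(** A condition under which the mixed derivative of [g * w] vanishes: the derivative of [g] in [x]
    or in [z] is zero. *)
Let not_x (g : S) := g^`M(i0) = 0 \/ g^`M(i2) = 0.

Let not_xM (g p : S) : p^`M(i0) = 0 -> p^`M(i2) = 0 -> not_x g -> not_x (g * p).
Proof. by move=> p0 p2 [g0|g2]; [left|right]; apply: mderivM0. Qed.

Let w0 : w^`M(i0) = 0. Proof. by rewrite mderiv4E. Qed.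
Let w2 : w^`M(i2) = 0. Proof. by rewrite mderiv4E. Qed.

(** The boolean [b] is the coefficient of [x y z]: for [true] purity comes from the Cartier
    splitting, for [false] the stalk at the origin refutes it. *)
Lemma classifiedP L (f al be : S) (b : bool) :
  f = z ^+ 2 + b%:R * (x * y * z) + al * x ^+ 2 + be * y ^+ 2 ->
  (b -> mderiv_all (al * w) = 0 /\ mderiv_all (be * w) = 0) ->
  (b <-> pure_label L) ->
  ~ Spec_F_rational 2 (pquot f) /\
    ((b%:R : S) = 0 -> ~ Spec_F_pure 2 (pquot f)) ->
  classified L f.
Proof.
move=> fE D0 bL [nrat npure]; split=> //; apply: iff_trans bL.
case: b fE D0 npure => fE D0 npure; split=> //; last by move/(npure erefl).
have [al0 be0] := D0 isT; move=> _; apply: (Cartier_Spec_F_pure char_k).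
exact: mderiv_all_family fE _ _.
Qed.

Lemma classified_DB L (f g : S) (b : bool) :
  f = z ^+ 2 + b%:R * (x * y * z) + w * x ^+ 2 + g * y ^+ 2 ->
  wfree g -> (b -> not_x g) -> (b <-> pure_label L) -> classified L f.
Proof.
move=> fE g_wfree gx bL; apply: (classifiedP fE _ bL).
  move=> /gx g0; split; last by apply: mderiv_all_eq0; apply: not_xM.
  by apply: mderiv_all_eq0; left; apply: mderivM0.
(* On [y = 0] the equation is [z^2 + w x^2], parametrized in characteristic two by [z = x w] with
   [w] replaced by [w^2]. *)
apply: (not_F_rational_linear_w fE (v := x) (m := 2)
  (g := z ^+ 2 + b%:R * (x * y * z) + g * y ^+ 2) (p0 := x) (p2 := x * w) (p3 := w ^+ 2)).
- by left.
- have wx := @wfreex k; have wy := @wfreey k; have wz := @wfreez k.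
  have wb : wfree (b%:R : S) by case: (b); [exact: wfree1|exact: wfree0].
  by do ![exact: wx|exact: wy|exact: wz|exact: wb|exact: g_wfree
        |apply: wfreeX|apply: wfreeM|apply: wfreeD].
- by rewrite fE; ring.
- rewrite fE !rmorphD !rmorphM /= !substXE.
  transitivity ((x * w) ^+ 2 + (x * w) ^+ 2); first by ring.
  exact: (addrr_pchar2 (mpoly_pchar2 4 char_k)).
- exact: XU_neq0.
- by rewrite substXE.
- by rewrite rmorphXn /= substXE expf_neq0.
- by rewrite rmorphM /= substXE mul0r.
- by rewrite rmorphXn /= substXE expr0n.
Qed.

Lemma classified_DC L (f g : S) (m : nat) (b : bool) :
  f = z ^+ 2 + b%:R * (x * y * z) + y * x ^+ 2 + (g + w * y ^+ m) * y ^+ 2 ->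
  wfree g -> (b -> not_x g) -> (b <-> pure_label L) -> classified L f.
Proof.
move=> fE g_wfree gx bL; apply: (classifiedP fE _ bL).
  move=> /gx g0; split; first by apply: mderiv_all_eq0; left; apply: mderivM0; rewrite ?mderiv4E.
  rewrite mulrDl mderiv_allD !mderiv_all_eq0 ?addr0 //; last exact: not_xM.
  by left; do !apply: mderivM0; rewrite ?mderiv4E // mderivX0 ?mderiv4E.
(* On [y = 0] the equation is [z^2], so [y = z = 0] is the surface used. *)
apply: (not_F_rational_linear_w fE (v := y) (m := m.+2)
  (g := z ^+ 2 + b%:R * (x * y * z) + y * x ^+ 2 + g * y ^+ 2) (p0 := x) (p2 := 0) (p3 := w)).
- by right.
- have wx := @wfreex k; have wy := @wfreey k; have wz := @wfreez k.
  have wb : wfree (b%:R : S) by case: (b); [exact: wfree1|exact: wfree0].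
  by do ![exact: wx|exact: wy|exact: wz|exact: wb|exact: g_wfree
        |apply: wfreeX|apply: wfreeM|apply: wfreeD].
- by rewrite fE !exprS; ring.
- by rewrite fE !rmorphD !rmorphM /= !substXE; ring.
- exact: XU_neq0.
- by rewrite substXE.
- by rewrite substXE.
- by rewrite rmorph0.
- by rewrite substXE.
Qed.

Lemma classified_EF L (f g : S) (b : bool) :
  f = z ^+ 2 + b%:R * (x * y * z) + x * x ^+ 2 + (g + w * y ^+ 2) * y ^+ 2 ->
  wfree g -> (b -> not_x g) -> (b <-> pure_label L) -> classified L f.
Proof.
move=> fE g_wfree gx bL; apply: (classifiedP fE _ bL).
  move=> /gx g0; split.
    by apply: mderiv_all_eq0; right; apply: mderivM0; rewrite ?mderiv4E.
  rewrite mulrDl mderiv_allD !mderiv_all_eq0 ?addr0 //; last exact: not_xM.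
  by left; do !apply: mderivM0; rewrite ?mderiv4E // mderivX0 ?mderiv4E.
(* On [y = 0] the equation is the cusp [z^2 + x^3], parametrized by [(x^2, x^3)]. *)
apply: (not_F_rational_linear_w fE (v := y) (m := 4)
  (g := z ^+ 2 + b%:R * (x * y * z) + x * x ^+ 2 + g * y ^+ 2)
  (p0 := x ^+ 2) (p2 := x ^+ 3) (p3 := w)).
- by right.
- have wx := @wfreex k; have wy := @wfreey k; have wz := @wfreez k.
  have wb : wfree (b%:R : S) by case: (b); [exact: wfree1|exact: wfree0].
  by do ![exact: wx|exact: wy|exact: wz|exact: wb|exact: g_wfree
        |apply: wfreeX|apply: wfreeM|apply: wfreeD].
- by rewrite fE; ring.
- rewrite fE !rmorphD !rmorphM /= !substXE.
  transitivity (x ^+ 6 + x ^+ 6); first by ring.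
  exact: (addrr_pchar2 (mpoly_pchar2 4 char_k)).
- by rewrite expf_neq0.
- by rewrite rmorphXn /= substXE expr0n.
- by rewrite substXE.
- by rewrite rmorphXn /= substXE expr0n.
- by rewrite substXE.
Qed.

Lemma mderivD0 i (p q : S) : p^`M(i) = 0 -> q^`M(i) = 0 -> (p + q)^`M(i) = 0.
Proof. by move=> p0 q0; rewrite mderivD p0 q0 addr0. Qed.

Ltac mderiv_zero :=
  do ![by rewrite mderiv4E | by rewrite mderiv0
      | apply: mderivD0 | apply: mderivX0 | apply: mderivM0].
Ltac z_free := by move=> _; right; mderiv_zero.
Ltac x_free := by move=> _; left; mderiv_zero.
Ltac pick_label := first
  [ by left; (congr DB || congr DC); lia
  | by (congr DB || congr DC); lia
  | right; pick_label ].
Ltac pure_label_tac n :=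
  by split=> // _; rewrite /pure_label; first [by tauto | do 4 right; exists n; [lia | pick_label]].

(** In each case [g] is what remains after taking out [y^2]; exponents are written as [n'.+2] and
    [m'.+2] for this purpose. *)
Lemma listed_classified L (f : S) : listed L f -> classified L f.
Proof.
case.
- apply: (classified_DB (g := y) (b := true));
    [family_side..|z_free|pure_label_tac 3%N].
- apply: (classified_DB (g := x) (b := true));
    [family_side..|z_free|pure_label_tac 3%N].
- apply: (classified_DB (g := y) (b := false));
    [family_side..|done|not_pure_label].
- apply: (classified_DB (g := x) (b := false));
    [family_side..|done|not_pure_label].
- apply: (classified_DC (g := z) (m := 1) (b := true));
    [family_side..|x_free|pure_label_tac 3%N].
- apply: (classified_DC (g := z) (m := 1) (b := false));
    [family_side..|done|not_pure_label].
- apply: (classified_DB (g := x * y + y ^+ 3) (b := true));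
    [family_side..|z_free|pure_label_tac 3%N].
- apply: (classified_DB (g := x * y) (b := true));
    [family_side..|z_free|pure_label_tac 3%N].
- apply: (classified_DC (g := x * y) (m := 2) (b := true));
    [family_side..|z_free|pure_label_tac 3%N].
- apply: (classified_DB (g := x * y + y ^+ 3) (b := false));
    [family_side..|done|not_pure_label].
- apply: (classified_DB (g := x * y) (b := false));
    [family_side..|done|not_pure_label].
- apply: (classified_DC (g := x * y + x * z) (m := 1) (b := false));
    [family_side..|done|not_pure_label].
- apply: (classified_DC (g := x * y + x * z) (m := 2) (b := false));
    [family_side..|done|not_pure_label].
- apply: (classified_DC (g := x * y) (m := 1) (b := false));
    [family_side..|done|not_pure_label].
- apply: (classified_DC (g := x * y) (m := 2) (b := false));
    [family_side..|done|not_pure_label].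
- apply: (classified_DB (g := y ^+ 3) (b := true));
    [family_side..|z_free|pure_label_tac 3%N].
- apply: (classified_DC (g := y * z) (m := 3) (b := true));
    [family_side..|x_free|pure_label_tac 3%N].
- apply: (classified_DC (g := y * z + x * z) (m := 2) (b := false));
    [family_side..|done|not_pure_label].
- apply: (classified_DC (g := y * z + x * z) (m := 3) (b := false));
    [family_side..|done|not_pure_label].
- apply: (classified_DC (g := y * z) (m := 2) (b := false));
    [family_side..|done|not_pure_label].
- apply: (classified_DC (g := y * z) (m := 3) (b := false));
    [family_side..|done|not_pure_label].
- move=> n r m h1 h2 h3 h4 h5.
  have [n' En] : exists n', n = n'.+2 by exists (n - 2)%N; lia.
  have [m' Em] : exists m', (2 * m + 1 = m'.+2)%N by exists (2 * m - 1)%N; lia.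
  (* For [n - r = 1] the term in [z] is [x y z], so [b = true], and the bounds force [m = n - 1].
     For larger [n - r] the term is divisible by [y^2] and joins [g]. *)
  case E: (n - r)%N => [|[|j]]; first lia.
  + rewrite Em [in y ^+ n]En;
    apply: (classified_DB (g := x * y ^+ n' + y ^+ m') (b := true));
    [family_side..|z_free|pure_label_tac n].
  + rewrite Em [in y ^+ n]En;
    apply: (classified_DB (g := x * y ^+ n' + x * y ^+ j * z + y ^+ m') (b := false));
    [family_side..|done|not_pure_label].
- move=> n r h1 h2 h3.
  have [n' En] : exists n', n = n'.+2 by exists (n - 2)%N; lia.
  case E: (n - r)%N => [|[|j]]; first lia.
  + rewrite [in y ^+ n]En;
    apply: (classified_DB (g := x * y ^+ n') (b := true));
    [family_side..|z_free|pure_label_tac n].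
  + rewrite [in y ^+ n]En;
    apply: (classified_DB (g := x * y ^+ n' + x * y ^+ j * z) (b := false));
    [family_side..|done|not_pure_label].
- move=> n r m h1 h2 h3 h4 h5.
  have [n' En] : exists n', n = n'.+2 by exists (n - 2)%N; lia.
  have [m' Em] : exists m', m = m'.+2 by exists (m - 2)%N; lia.
  (* With [r = n - 1] the bounds leave only [m = 2 n - 2]. *)
  case E: (n - r)%N => [|[|j]]; first lia.
  + rewrite [in y ^+ n]En [in y ^+ m]Em;
    apply: (classified_DC (g := x * y ^+ n') (m := m') (b := true));
    [family_side..|z_free|pure_label_tac n].
  + rewrite [in y ^+ n]En [in y ^+ m]Em;
    apply: (classified_DC (g := x * y ^+ n' + x * y ^+ j * z) (m := m') (b := false));
    [family_side..|done|not_pure_label].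
- move=> n r m h1 h2 h3 h4 h5.
  have [n' En] : exists n', n = n'.+2 by exists (n - 2)%N; lia.
  have [m' Em] : exists m', (2 * m + 1 = m'.+2)%N by exists (2 * m - 1)%N; lia.
  (* From [2 r <= n] and [n >= 4] it follows that [n - r >= 2], so no term [x y z] arises. *)
  have [j Ej] : exists j, (n - r = j.+2)%N by exists (n - r - 2)%N; lia.
  rewrite Em Ej [in y ^+ n]En;
  apply: (classified_DB (g := x * y ^+ n' + x * y ^+ j * z + y ^+ m') (b := false));
    [family_side..|done|not_pure_label].
- move=> n r h1 h2 h3.
  have [n' En] : exists n', n = n'.+2 by exists (n - 2)%N; lia.
  have [j Ej] : exists j, (n - r = j.+2)%N by exists (n - r - 2)%N; lia.
  rewrite Ej [in y ^+ n]En;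
  apply: (classified_DB (g := x * y ^+ n' + x * y ^+ j * z) (b := false));
    [family_side..|done|not_pure_label].
- move=> n r m h1 h2 h3 h4 h5.
  have [n' En] : exists n', n = n'.+2 by exists (n - 2)%N; lia.
  have [m' Em] : exists m', m = m'.+2 by exists (m - 2)%N; lia.
  have [j Ej] : exists j, (n - r = j.+2)%N by exists (n - r - 2)%N; lia.
  rewrite Ej [in y ^+ n]En [in y ^+ m]Em;
  apply: (classified_DC (g := x * y ^+ n' + x * y ^+ j * z) (m := m') (b := false));
    [family_side..|done|not_pure_label].
- move=> n m h1 h2 h3 h4.
  have [n' En] : exists n', n = n'.+2 by exists (n - 2)%N; lia.
  have [m' Em] : exists m', (2 * m + 1 = m'.+2)%N by exists (2 * m - 1)%N; lia.
  rewrite Em [in y ^+ n]En;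
  apply: (classified_DB (g := x * y ^+ n' + y ^+ m') (b := false));
    [family_side..|done|not_pure_label].
- move=> n h1 h2.
  have [n' En] : exists n', n = n'.+2 by exists (n - 2)%N; lia.
  rewrite [in y ^+ n]En;
  apply: (classified_DB (g := x * y ^+ n') (b := false));
    [family_side..|done|not_pure_label].
- move=> n m h1 h2 h3.
  have [n' En] : exists n', n = n'.+2 by exists (n - 2)%N; lia.
  have [m' Em] : exists m', m = m'.+2 by exists (m - 2)%N; lia.
  rewrite [in y ^+ n]En [in y ^+ m]Em;
  apply: (classified_DC (g := x * y ^+ n') (m := m') (b := false));
    [family_side..|done|not_pure_label].
- move=> n h1.
  have [m' Em] : exists m', (2 * n - 1 = m'.+2)%N by exists (2 * n - 3)%N; lia.
  rewrite Em;
  apply: (classified_DB (g := y ^+ m') (b := true));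
    [family_side..|z_free|pure_label_tac n].
- move=> n r m h1 h2 h3 h4 h5.
  have [n' En] : exists n', n = n'.+2 by exists (n - 2)%N; lia.
  have [m' Em] : exists m', m = m'.+2 by exists (m - 2)%N; lia.
  (* With [r = n - 1] the bounds leave only [m = 2 n - 1]. *)
  case E: (n - r)%N => [|[|j]]; first lia.
  + rewrite [in y ^+ n]En [in y ^+ m]Em;
    apply: (classified_DC (g := y ^+ n' * z) (m := m') (b := true));
    [family_side..|x_free|pure_label_tac n].
  + rewrite [in y ^+ n]En [in y ^+ m]Em;
    apply: (classified_DC (g := y ^+ n' * z + x * y ^+ j * z) (m := m') (b := false));
    [family_side..|done|not_pure_label].
- move=> n r m h1 h2 h3 h4 h5.
  have [n' En] : exists n', n = n'.+2 by exists (n - 2)%N; lia.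
  have [m' Em] : exists m', m = m'.+2 by exists (m - 2)%N; lia.
  have [j Ej] : exists j, (n - r = j.+2)%N by exists (n - r - 2)%N; lia.
  rewrite Ej [in y ^+ n]En [in y ^+ m]Em;
  apply: (classified_DC (g := y ^+ n' * z + x * y ^+ j * z) (m := m') (b := false));
    [family_side..|done|not_pure_label].
- move=> n m h1 h2 h3.
  have [n' En] : exists n', n = n'.+2 by exists (n - 2)%N; lia.
  have [m' Em] : exists m', m = m'.+2 by exists (m - 2)%N; lia.
  rewrite [in y ^+ n]En [in y ^+ m]Em;
  apply: (classified_DC (g := y ^+ n' * z) (m := m') (b := false));
    [family_side..|done|not_pure_label].
- apply: (classified_EF (g := x * y) (b := true));
    [family_side..|z_free|pure_label_tac 3%N].
- apply: (classified_EF (g := x * y + y * z) (b := false));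
    [family_side..|done|not_pure_label].
- apply: (classified_EF (g := x * y) (b := false));
    [family_side..|done|not_pure_label].
- apply: (classified_EF (g := y * z) (b := false));
    [family_side..|done|not_pure_label].
- apply: (classified_EF (g := x * z) (b := false));
    [family_side..|done|not_pure_label].
- apply: (classified_EF (g := x * y * z) (b := false));
    [family_side..|done|not_pure_label].
- apply: (classified_EF (g := 0) (b := false));
    [family_side..|done|not_pure_label].
Qed.

End Classification.

Theorem proposition4p2 (k : closedFieldType) (char_k : 2%N \in [pchar k])
    (L : label) (f : {mpoly k[4]}) (L_f : listed L f) :
  (Spec_F_pure 2 (pquot f) <->
     (L = EF 7 3 \/ L = DB 4 1 1 \/ L = DB 4 1 2 \/ L = DC 5 1 3 \/
      exists2 n : nat, (3 <= n)%N &
        (L = DB (2 * n) (n - 1) (n - 1) \/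
         L = DB (2 * n) (n - 1) n \/
         L = DC (2 * n) (n - 1) (2 * n - 2) \/
         L = DB (2 * n + 1) (n - 1) (n - 1) \/
         L = DC (2 * n + 1) (n - 1) (2 * n - 1)))) /\
  ~ Spec_F_rational 2 (pquot f).
Proof. exact: listed_classified. Qed.
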